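(* Let $(\mathcal M,g)$ be a semi-Riemannian manifold of dimension $m$ and assume that there are commuting Killing vector fields that span a null distribution (i.e., a distribution on which $g$ degenerates) of rank $m-1$. Then $(\mathcal M,g)$ admits a parallel null vector field $V$ and its curvature satisfies \[R(X,Y)Z=0\quad\text{ and }\quad \nabla_XR=0\] for all $X,Y,Z\in V^\perp$. In particular, if $(\mathcal M,g)$ is Lorentzian, then it is a plane wave.
   Context: $\nabla$ is the Levi-Civita connection of $g$, $R(X,Y)=[\nabla_X,\nabla_Y]-\nabla_{[X,Y]}$ is its curvature, and $V^\perp=\{X\in T\mathcal M\mid g(X,V)=0\}$. A vector field $K$ is a Killing vector field if $g(\nabla_XK,Y)+g(X,\nabla_YK)=0$ for all $X,Y\in T\mathcal M$. A vector field $V$ is null if $V\neq 0$ and $g(V,V)=0$; it is parallel if $\nabla V=0$. A Lorentzian manifold is a pp-wave if it admits a parallel null vector field $V$ and if its curvature endomorphism $R:\Lambda^2T\mathcal M\to\Lambda^2T\mathcal M$ is non-zero and satisfies $R|_{V^\perp\wedge V^\perp}=0$. A plane wave is a pp-wave satisfying in addition $\nabla_UR=0$ for all $U\in V^\perp$.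
   Formalization: Added since the claim fails otherwise: the null direction of the distribution is spanned by a nowhere-zero constant-coefficient combination of the given Killing fields; and, for the plane wave conclusion, the curvature is not identically zero (flat Minkowski space is excluded by definition). *)

(* Defs.v *)
From HB Require Import structures.
From mathcomp Require Import all_boot all_order all_algebra.
From mathcomp Require Import all_classical all_reals all_analysis.
Set Implicit Arguments.
Unset Strict Implicit.
Unset Printing Implicit Defensive.
Import Order.TTheory GRing.Theory Num.Theory.
Import numFieldNormedType.Exports.
Local Open Scope classical_set_scope.
Local Open Scope ring_scope.

Section LinearAlgebra.
Variables (R : realType) (V : lmodType R).

Definition lin_span (A : set V) : set V :=
  [set v | exists (k : nat) (e : 'I_k -> V) (c : 'I_k -> R),
     (forall i, A (e i)) /\ v = \sum_i c i *: e i].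

Definition lin_free (k : nat) (e : 'I_k -> V) : Prop :=
  forall c : 'I_k -> R, \sum_i c i *: e i = 0 -> forall i, c i = 0.

Definition has_dim (k : nat) (D : set V) : Prop :=
  exists e : 'I_k -> V, lin_free e /\ D = lin_span (range e).

Definition degenerate_on (b : V -> V -> R) (D : set V) : Prop :=
  exists v, [/\ D v, v <> 0 & forall w, D w -> b v w = 0].

End LinearAlgebra.

Section SmoothOn.
Variables (R : realType) (E W : normedModType R).

(* A function is C^(k+1) on the open set [U] iff it is differentiable there
   and all its directional derivatives are C^k on [U]. *)
Fixpoint Ck (k : nat) (U : set E) (f : E -> W) : Prop :=
  match k with
  | 0 => forall x, U x -> {for x, continuous f}
  | k'.+1 => (forall x, U x -> differentiable f x) /\
             (forall v, Ck k' U (fun x => 'D_v f x))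
  end.

Definition smooth_on (U : set E) (f : E -> W) : Prop := forall k, Ck k U f.

End SmoothOn.

(* [chart_map] and [chart_inv] are total functions; they are only meaningful
   on [chart_dom] and on its (open) image. *)
Record chart (R : realType) (m : nat) (T : topologicalType) := Chart {
  chart_dom : set T ;
  chart_map : T -> 'rV[R]_m ;
  chart_inv : 'rV[R]_m -> T ;
  chart_dom_open : open chart_dom ;
  chart_img_open : open (chart_map @` chart_dom) ;
  chart_mapK : forall x, chart_dom x -> chart_inv (chart_map x) = x ;
  chart_map_cont : forall x, chart_dom x -> {for x, continuous chart_map} ;
  chart_inv_cont : forall y, (chart_map @` chart_dom) y ->
    {for y, continuous chart_inv} }.

Record smooth_manifold (R : realType) (m : nat) := SmoothManifold {
  manifold_carrier :> topologicalType ;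
  manifold_hausdorff : hausdorff_space manifold_carrier ;
  manifold_second_countable : @second_countable manifold_carrier ;
  atlas : set (chart R m manifold_carrier) ;
  atlas_cover : forall x, exists2 c, atlas c & chart_dom c x ;
  atlas_compatible : forall c d, atlas c -> atlas d ->
    smooth_on (chart_map c @` (chart_dom c `&` chart_dom d))
              (chart_map d \o chart_inv c) }.

Section Manifold.
Variables (R : realType) (m : nat) (M : smooth_manifold R m).

Definition smooth_fun (f : M -> R) : Prop :=
  forall c, atlas c ->
    smooth_on (chart_map c @` chart_dom c)
              ((f \o chart_inv c : 'rV[R]_m -> R^o)).

(* Functionals on real functions on [M]; tangent vectors at a point are the
   functionals selected by [tangent] below. *)
Definition fnl : lmodType R := ((M -> R) -> R^o).

(* In every chart [c] around [p], [v] is [\sum_i a_i (d/dx_i)_p] for some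
   coefficient vector [a].  The value on non-smooth functions is set to 0, so
   that a tangent vector is determined by its action on smooth functions. *)
Definition tangent (p : M) (v : fnl) : Prop :=
  (forall f, ~ smooth_fun f -> v f = 0) /\
  forall c, atlas c -> chart_dom c p ->
    exists a : 'rV[R]_m, forall f, smooth_fun f ->
      v f = 'D_a ((f \o chart_inv c : 'rV[R]_m -> R^o)) (chart_map c p).

Definition rough_field : lmodType R := (M -> fnl).

Definition act (X : rough_field) (f : M -> R) : M -> R := fun p => X p f.

Definition vfield (X : rough_field) : Prop :=
  (forall p, tangent p (X p)) /\
  forall f, smooth_fun f -> smooth_fun (act X f).

Definition fmul (f : M -> R) (X : rough_field) : rough_field := fun p => f p *: X p.

Definition bracket (X Y : rough_field) : rough_field :=
  fun p f => X p (act Y f) - Y p (act X f).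

Definition pointwise_span (Ks : set rough_field) (p : M) : set fnl :=
  lin_span [set K p | K in Ks].

Definition metric := M -> fnl -> fnl -> R.

Definition inner (g : metric) (X Y : rough_field) : M -> R :=
  fun p => g p (X p) (Y p).

Definition neg_definite (g : metric) (p : M) (k : nat) : Prop :=
  exists e : 'I_k -> fnl,
    (forall i, tangent p (e i)) /\
    forall c : 'I_k -> R, (exists i, c i <> 0) ->
      g p (\sum_i c i *: e i) (\sum_i c i *: e i) < 0.

(* The maximal dimension of a negative definite subspace of the tangent space
   at [p] is [nu]. *)
Definition has_index (g : metric) (p : M) (nu : nat) : Prop :=
  neg_definite g p nu /\ forall k, neg_definite g p k -> (k <= nu)%N.

(* A smooth field of nondegenerate symmetric bilinear forms of constant index
   on the tangent spaces. *)
Definition semi_riemannian (g : metric) : Prop :=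
  [/\ forall p a u v w, tangent p u -> tangent p v -> tangent p w ->
        g p (a *: u + v) w = a * g p u w + g p v w,
      forall p u v, tangent p u -> tangent p v -> g p u v = g p v u,
      forall p u, tangent p u ->
        (forall v, tangent p v -> g p u v = 0) -> u = 0,
      forall X Y, vfield X -> vfield Y -> smooth_fun (inner g X Y)
    & exists nu, forall p, has_index g p nu].

(* Sign convention (-, +, ..., +). *)
Definition lorentzian (g : metric) : Prop :=
  semi_riemannian g /\ forall p, has_index g p 1.

Definition affine_connection (nabla : rough_field -> rough_field -> rough_field) : Prop :=
  [/\ forall X Y, vfield X -> vfield Y -> vfield (nabla X Y),
      forall X Y Z, vfield X -> vfield Y -> vfield Z ->
        nabla (X + Y) Z = nabla X Z + nabla Y Z,
      forall f X Y, smooth_fun f -> vfield X -> vfield Y ->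
        nabla (fmul f X) Y = fmul f (nabla X Y),
      forall X Y Z, vfield X -> vfield Y -> vfield Z ->
        nabla X (Y + Z) = nabla X Y + nabla X Z
    & forall f X Y, smooth_fun f -> vfield X -> vfield Y ->
        nabla X (fmul f Y) = fmul (act X f) Y + fmul f (nabla X Y)].

Definition levi_civita (g : metric) (nabla : rough_field -> rough_field -> rough_field) : Prop :=
  [/\ affine_connection nabla,
      forall X Y, vfield X -> vfield Y ->
        nabla X Y - nabla Y X = bracket X Y
    & forall X Y Z, vfield X -> vfield Y -> vfield Z ->
        act X (inner g Y Z) = inner g (nabla X Y) Z + inner g Y (nabla X Z)].

Section Connection.
Variables (g : metric) (nabla : rough_field -> rough_field -> rough_field).

Definition curv (X Y Z : rough_field) : rough_field :=
  nabla X (nabla Y Z) - nabla Y (nabla X Z) - nabla (bracket X Y) Z.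

(* [(nabla_X curv)(Y, Z) T] *)
Definition nabla_curv (X Y Z T : rough_field) : rough_field :=
  nabla X (curv Y Z T) - curv (nabla X Y) Z T - curv Y (nabla X Z) T
  - curv Y Z (nabla X T).

Definition killing (K : rough_field) : Prop :=
  vfield K /\ forall X Y, vfield X -> vfield Y ->
    inner g (nabla X K) Y + inner g X (nabla Y K) = 0.

Definition null_field (V : rough_field) : Prop :=
  vfield V /\ forall p, V p <> 0 /\ g p (V p) (V p) = 0.

Definition parallel (V : rough_field) : Prop :=
  vfield V /\ forall X, vfield X -> nabla X V = 0.

(* [X] is a vector field whose value at [p] lies in the fibre at [p] of the
   orthogonal complement of [V].  As [curv] and [nabla_curv] are tensors, the
   value at [p] of such fields ranges over all arguments in that fibre. *)
Definition perp_at (V : rough_field) (p : M) (X : rough_field) : Prop :=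
  vfield X /\ g p (X p) (V p) = 0.

Definition curv_flat_on_perp (V : rough_field) : Prop :=
  forall p X Y Z, perp_at V p X -> perp_at V p Y -> perp_at V p Z ->
    curv X Y Z p = 0.

Definition curv_parallel_along_perp (V : rough_field) : Prop :=
  forall p X, perp_at V p X ->
    forall Y Z T, vfield Y -> vfield Z -> vfield T ->
      nabla_curv X Y Z T p = 0.

Definition curv_nonzero : Prop :=
  exists X Y Z, [/\ vfield X, vfield Y, vfield Z & curv X Y Z <> 0].

(* The curvature endomorphism of bivectors sends X /\ Y to curv(X, Y), bivectors
   being identified through [g] with skew-adjoint endomorphisms of the tangent
   bundle; it vanishes on X /\ Y iff curv(X, Y) Z = 0 for every Z. *)
Definition curv_endo_zero_on_perp (V : rough_field) : Prop :=
  forall p X Y Z, perp_at V p X -> perp_at V p Y -> vfield Z ->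
    curv X Y Z p = 0.

Definition pp_wave_with (V : rough_field) : Prop :=
  [/\ lorentzian g, parallel V, null_field V, curv_nonzero
    & curv_endo_zero_on_perp V].

Definition plane_wave : Prop :=
  exists V, pp_wave_with V /\ curv_parallel_along_perp V.

End Connection.
End Manifold.

(* Main.v *)
Require Import Defs.
From HB Require Import structures.
From mathcomp Require Import all_boot all_order all_algebra.
From mathcomp Require Import all_classical all_reals all_analysis.
From mathcomp Require Import ring lra.
Set Implicit Arguments.
Unset Strict Implicit.
Unset Printing Implicit Defensive.
Import Order.TTheory GRing.Theory Num.Theory.
Import numFieldNormedType.Exports.
Local Open Scope classical_set_scope.
Local Open Scope ring_scope.

(* Let D be the span of the Killing fields and V = W the given combination of
   them that spans the kernel of g on D, so that D is the orthogonal complement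
   of V.  For K, L, N in D the tensor g(nabla_K L, N) is symmetric in K, L (the
   fields commute) and skew in K, N (L is Killing), hence it vanishes.  Likewise
   g(nabla_X V, Y) is skew and vanishes for X in the hyperplane D, so V is
   parallel; this "skew with a hyperplane in its kernel, hence zero" argument is
   used repeatedly.
   A Killing field is affine: its Lie derivative kills nabla and R.  Applied to
   the fields in D this gives R(K, L) N = 0, R(V, X) = 0 and R(K, X) N in RV.
   With A = nabla L, the vanishing Lie derivative turns (nabla_L R)(Y, Z) into
   [A, R(Y, Z)] - R(AY, Z) - R(Y, AZ).  Since A maps V to 0, D to RV and
   everything to D, this vanishes for Y in D, and then for all Y, Z by skewness.
   To evaluate tensors pointwise one needs that every tangent vector extends to
   a smooth field, which is where bump functions enter. *)

(** * Functions of class [C^k] *)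

Section CkTheory.
Variable R : realType.
Implicit Types E W : normedModType R.

(** A quadratic bound is o(h), and at h = 0 it forces [d x = 0]. With [C = 0] it handles maps that
    vanish near [x], and with a factorial it handles [expinv] at the origin. *)
Lemma is_diff_quadratic E W (d : E -> W) (x : E) (C : R) :
  (\forall h \near (0 : E), `|d (h + x)| <= C * `|h| ^+ 2) ->
  is_diff x d (fun=> 0).
Proof.
move=> H.
have dx0 : d x = 0.
  have := nbhs_singleton H; rewrite add0r normr0 expr0n mulr0 => H0.
  by apply/eqP; rewrite -normr_le0.
have E0 : d \o shift x = cst (d x) + (\0 : E -> W) +o_ (0 : E) id.
  apply/eqaddoP => e e0.
  rewrite -[_ - _](_ : d \o shift x = _); last first.
    by apply/funext => y; rewrite /= !fctE/= dx0 !add0r subr0.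
  have B0 : \forall h \near (0 : E), `|C| * `|h| <= e.
    near=> h.
    have : `|h| <= e / (`|C| + 1).
      by near: h; apply: nbhs0_le; rewrite divr_gt0// ltr_wpDl.
    rewrite ler_pdivlMr ?ltr_wpDl// mulrDr mulr1 mulrC => Hh.
    by apply: le_trans Hh; rewrite lerDl.
  near=> h; rewrite /=.
  have h1 : `|d (h + x)| <= C * `|h| ^+ 2 by near: h.
  have h2 : `|C| * `|h| <= e by near: h.
  apply: (le_trans h1); rewrite expr2 mulrA ler_wpM2r//.
  by apply: le_trans h2; rewrite ler_wpM2r// ler_norm.
have dE : 'd d x = (\0 : E -> W) :> (E -> W).
  by apply: diff_unique E0; exact: cst_continuous.
split=> //; apply/diff_locallyP; rewrite dE; split=> //; exact: cst_continuous.
Unshelve. all: by end_near. Qed.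

Lemma near_differentiable E W (f g : E -> W) (x : E) :
  (\forall y \near x, f y = g y) -> differentiable f x -> differentiable g x.
Proof.
move=> fg df.
have -> : g = f + (g - f) by rewrite addrC subrK.
apply: differentiableD => //.
have [] // := @is_diff_quadratic _ _ (g - f) x 0.
have fg' : \forall h \near (0 : E), f (h + x) = g (h + x).
  by rewrite (near_shift x) sub0r; apply: filterS fg => y; rewrite /= subrK.
by apply: filterS fg' => h fgh; rewrite !fctE fgh subrr normr0 mul0r.
Qed.

Lemma Ck_differentiable E W k (U : set E) (f : E -> W) :
  Ck k.+1 U f -> forall x, U x -> differentiable f x.
Proof. by move=> [df _] x Ux; exact: df. Qed.

Lemma Ck_derive E W k (U : set E) (f : E -> W) (v : E) :
  Ck k.+1 U f -> Ck k U ('D_v f).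
Proof. by move=> [_ Df]; exact: Df. Qed.

Lemma Ck_ext E W k (U : set E) (f g : E -> W) : open U ->
  (forall x, U x -> f x = g x) -> Ck k U f -> Ck k U g.
Proof.
move=> Uo.
elim: k f g => [|k IH] f g fg /=.
  move=> cf x Ux.
  have N : \forall y \near x, f y = g y.
    by apply: filterS (open_nbhs_nbhs (conj Uo Ux)); exact: fg.
  rewrite /prop_for /continuous_at -(fg x Ux).
  apply: cvg_trans (cf x Ux); apply: near_eq_cvg.
  by apply: filterS N => y ->.
move=> [df Df]; split.
  move=> x Ux; apply: near_differentiable (df x Ux).
  by apply: filterS (open_nbhs_nbhs (conj Uo Ux)); exact: fg.
move=> v; apply: IH (Df v) => x Ux; apply: near_eq_derive.
by apply: filterS (open_nbhs_nbhs (conj Uo Ux)); exact: fg.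
Qed.

Lemma CkS E W k (U : set E) (f : E -> W) : Ck k.+1 U f -> Ck k U f.
Proof.
elim: k f => [|k IH] f [df Df]; last by split=> // v; exact: IH.
by move=> x Ux; apply: differentiable_continuous; exact: df.
Qed.

Lemma Ck_subset E W k (U U' : set E) (f : E -> W) : U' `<=` U ->
  Ck k U f -> Ck k U' f.
Proof.
move=> UU; elim: k f => [|k IH] f /=; first by move=> H x /UU; exact: H.
by move=> [H1 H2]; split=> [x /UU|v]; [exact: H1|exact/IH].
Qed.

(** [Ck] is a condition at each point of the set, with derivatives taken in the ambient space; so
    [U'] may vary with the point and need not be open. *)
Lemma Ck_locally E W k (U : set E) (f : E -> W) :
  (forall x, U x -> exists2 U', U' x & Ck k U' f) -> Ck k U f.
Proof.
elim: k f => [|k IH] f H /=.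
  by move=> x /H[U' U'x]; exact.
split=> [x /H[U' U'x [+ _]]|v]; first exact.
by apply: IH => x /H[U' U'x [_ /(_ v)]]; exists U'.
Qed.

Lemma Ck_cst E W k (U : set E) (a : W) : Ck k U (fun=> a).
Proof.
elim: k a => [|k IH] a /=; first by move=> x _; exact: cst_continuous.
split=> [x _|v]; first exact: differentiable_cst.
have -> : (fun x : E => 'D_v (fun=> a) x) = (fun=> 0).
  by apply/funext => x; rewrite derive_cst.
exact: IH.
Qed.

Lemma CkD E W k (U : set E) (f g : E -> W) : open U ->
  Ck k U f -> Ck k U g -> Ck k U (fun x => f x + g x).
Proof.
move=> Uo; elim: k f g => [|k IH] f g /=.
  by move=> cf cg x Ux; apply: continuousD; [exact: cf|exact: cg].
move=> [df Df] [dg Dg]; split.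
  by move=> x Ux; apply: (differentiableD (f := f) (g := g)); [exact: df|exact: dg].
move=> v; apply: (@Ck_ext _ _ _ _ (fun x => 'D_v f x + 'D_v g x)) => //.
  by move=> x Ux; rewrite -deriveD//; apply: diff_derivable; [exact: df|exact: dg].
exact: IH.
Qed.

Lemma Ck_sum E W k (U : set E) n (f : 'I_n -> E -> W) : open U ->
  (forall i, Ck k U (f i)) -> Ck k U (fun x => \sum_i f i x).
Proof.
move=> Uo; elim: n f => [|n IH] f Hf.
  by under eq_fun do rewrite big_ord0; exact: Ck_cst.
under eq_fun do rewrite big_ord_recl; apply: CkD => //.
by apply: (IH (fun i => f (lift ord0 i))) => i; exact: Hf.
Qed.

Lemma CkM E k (U : set E) (f g : E -> R^o) : open U ->
  Ck k U f -> Ck k U g -> Ck k U (fun x => f x * g x : R^o).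
Proof.
move=> Uo; elim: k f g => [|k IH] f g.
  by move=> cf cg x Ux; apply: (continuousM (s := f) (t := g)); [exact: cf|exact: cg].
move=> cf cg; have [df Df] := cf; have [dg Dg] := cg; split.
  by move=> x Ux; apply: (differentiableM (f := f) (g := g)); [exact: df|exact: dg].
move=> v; apply: (@Ck_ext _ _ _ _ (fun x => f x * 'D_v g x + g x * 'D_v f x : R^o)) => //.
  move=> x Ux; rewrite (deriveM (f := f) (g := g))//; apply: diff_derivable.
    exact: df.
  exact: dg.
apply: CkD => //; apply: IH; [exact: CkS cf|exact: Dg|exact: CkS cg|exact: Df].
Qed.

Lemma derive_coord E n (h : E -> 'rV[R]_n) (x v : E) i :
  differentiable h x ->
  'D_v (fun y => h y 0 i : R^o) x = 'D_v h x 0 i.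
Proof. by move=> dh; rewrite (derive_mx (diff_derivable dh)) mxE. Qed.

Lemma Ck_coord E k (U : set E) n (h : E -> 'rV[R]_n) i : open U ->
  Ck k U h -> Ck k U (fun x => h x 0 i : R^o).
Proof.
move=> Uo; elim: k h => [|k IH] h.
  move=> ch x Ux; apply: (@continuous_comp _ _ _ h (fun y : 'rV[R]_n => y 0 i : R^o)).
    exact: ch.
  exact: coord_continuous.
move=> [dh Dh]; split.
  move=> x Ux; apply: (@differentiable_comp _ _ _ _ h (fun y : 'rV[R]_n => y 0 i : R^o)).
    exact: dh.
  exact: differentiable_coord.
move=> v; apply: (@Ck_ext _ _ _ _ (fun x => 'D_v h x 0 i : R^o)) => //.
  by move=> x Ux; rewrite derive_coord//; exact: dh.
exact: (IH _ (Dh v)).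
Qed.

Lemma derive_comp_rV E n (h : E -> 'rV[R]_n) (f : 'rV[R]_n -> R^o) (x v : E) :
  differentiable h x -> differentiable f (h x) ->
  'D_v (f \o h) x = 'D_('D_v h x) f (h x).
Proof.
move=> dh df; rewrite !deriveE//; last exact: differentiable_comp.
by rewrite diff_comp.
Qed.

Lemma derive_rVE n (f : 'rV[R]_n -> R^o) (x v : 'rV[R]_n) :
  differentiable f x ->
  'D_v f x = \sum_i v 0 i * 'D_(delta_mx 0 i) f x.
Proof.
move=> df; rewrite deriveE// {1}(row_sum_delta v) linear_sum.
by apply: eq_bigr => i _; rewrite linearZ/= deriveE.
Qed.

(** The chain rule differentiates [f] in the direction ['D_v h x], which varies with [x]. Expanding
    it in the standard basis leaves derivatives of [f] in fixed directions, to which the induction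
    applies. *)
Lemma Ck_comp E k (U : set E) n (U' : set 'rV[R]_n) (h : E -> 'rV[R]_n)
    (f : 'rV[R]_n -> R^o) : open U ->
  (forall x, U x -> U' (h x)) -> Ck k U h -> Ck k U' f -> Ck k U (f \o h).
Proof.
move=> Uo hU; elim: k f => [|k IH] f.
  by move=> ch cf x Ux; apply: continuous_comp; [exact: ch|apply: cf; exact: hU].
move=> ch cf; have [dh Dh] := ch; have [df Df] := cf; split.
  by move=> x Ux; apply: differentiable_comp; [exact: dh|apply: df; exact: hU].
move=> v; apply: (@Ck_ext _ _ _ _
    (fun x => \sum_i ('D_v h x 0 i * ('D_(delta_mx 0 i) f \o h) x) : R^o)) => //.
  move=> x Ux; rewrite derive_comp_rV; [|exact: dh|by apply: df; exact: hU].
  by rewrite [in RHS]derive_rVE//; apply: df; exact: hU.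
apply: Ck_sum => // i; apply: CkM => //; first by apply: Ck_coord => //; exact: Dh.
by apply: IH; [exact: CkS ch|exact: Df].
Qed.

End CkTheory.

(** * Bump functions *)

Section Bump.
Variable R : realType.

(* [expinv n t = t^-n exp(-1/t)] extended by 0: this family is closed under
   differentiation up to linear combinations. *)
Definition expinv (n : nat) (t : R) : R^o :=
  if 0 < t then t ^- n * expR (- t^-1) else 0.

Lemma expinv_le0 n t : t <= 0 -> expinv n t = 0.
Proof. by move=> t0; rewrite /expinv ltNge t0. Qed.

Lemma expinv_gt0 n t : 0 < t -> 0 < expinv n t.
Proof. by move=> t0; rewrite /expinv t0 mulr_gt0 ?expR_gt0// invr_gt0 exprn_gt0. Qed.

(** With s = 1/t the exponential series gives s^(n+2)/(n+2)! <= exp s, that is exp(-1/t) <= (n+2)!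
    t^(n+2); dividing by t^n leaves t^2. *)
Lemma expinv_quadratic n t : `|expinv n t| <= (n.+2)`!%:R * `|t| ^+ 2.
Proof.
rewrite /expinv; case: ltP => t0; last by rewrite normr0 mulr_ge0// exprn_ge0.
rewrite (ger0_norm (ltW t0)) ger0_norm; last first.
  by rewrite mulr_ge0 ?expR_ge0// invr_ge0 exprn_ge0// ltW.
have ti0 : 0 <= t^-1 by rewrite invr_ge0 ltW.
have := expR_ge1Dxn n.+1 ti0 => H.
have {H} H : t^-1 ^+ n.+2 / (n.+2)`!%:R <= expR t^-1.
  by apply: le_trans H; rewrite lerDr.
rewrite expRN ler_pdivrMl ?exprn_gt0// -[X in X <= _]mul1r ler_pdivrMr ?expR_gt0//.
move: H; rewrite ler_pdivrMr ?ltr0n ?fact_gt0// exprVn.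
rewrite -(ler_pM2l (_ : 0 < t ^+ n.+2)) ?exprn_gt0// divff ?lt0r_neq0 ?exprn_gt0//.
move=> /le_trans; apply; rewrite le_eqVlt; apply/orP; left; apply/eqP.
by rewrite -addn2 exprD; ring.
Qed.

(** For t < 0 the function vanishes nearby, for t > 0 the rules of calculus apply, and at t = 0 the
    quadratic bound gives the differential 0. *)
Lemma is_diff_expinv n (t : R) :
  is_diff (t : R^o) (expinv n) (fun v => v * (- n%:R * expinv n.+1 t + expinv n.+2 t)).
Proof.
case: (ltgtP t 0) => t0.
- have [] // := @is_diff_quadratic _ R^o R^o (expinv n) t 0.
    have : \forall h \near (0 : R), h + t < 0.
      near=> h; rewrite -ltrBrDr sub0r; near: h.
      by apply: lt_nbhsl; rewrite oppr_gt0.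
    by apply: filterS => h ht; rewrite expinv_le0 ?normr0 ?mul0r// ltW.
  move=> H1 H2; split=> //; rewrite H2; apply/funext => v.
  by rewrite !expinv_le0 ?(ltW t0)// mulr0 addr0 mulr0.
- have tn0 : t != 0 by rewrite gt_eqF.
  pose f : R -> R := fun t => t ^- n * expR (- t^-1).
  have df : is_derive t 1 f (- n%:R * expinv n.+1 t + expinv n.+2 t).
    have -> : f = (fun t => (t ^+ n)^-1) * (expR \o (fun t => - t^-1)).
      by apply/funext.
    have dV : is_derive t 1 (fun s : R => - s^-1) (t ^- 2).
      have := @is_deriveV R id t 1 1 tn0 (is_derive_id _ _) => dV.
      by apply: is_derive_eq; rewrite scaleNr opprK /GRing.scale/= mulr1.
    have dE := @is_derive1_comp R expR (fun s => - s^-1) t _ _ (is_derive_expR _) dV.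
    have dP : is_derive t 1 (fun s : R => (s ^+ n)^-1) (- n%:R * t ^- n.+1).
      have tn : t ^+ n != 0 by rewrite expf_neq0.
      have dX := is_deriveX n (is_derive_id t (1 : R)); rewrite exprfctE in dX.
      have dV' := @is_deriveV R (fun s => s ^+ n) t _ 1 tn dX.
      apply: is_derive_eq; rewrite /GRing.scale/= mulr1.
      (* At n = 0 the truncated exponent [n.-1] is harmless, because the factor [n%:R] is 0. *)
      have nE : n%:R * t ^+ n.-1 = n%:R * t ^+ n / t.
        by case: (n) => [|k]; rewrite ?mul0r// exprSr mulrA mulfK.
      rewrite nE (exprSr t n); move: tn; set a := t ^+ n; move: (n%:R : R) => N a0.
      by field; rewrite tn0 a0.
    apply: is_derive_eq; rewrite /GRing.scale/= /expinv t0.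
    rewrite [t ^+ n.+1]exprS [t ^+ n.+2]exprS [t ^+ n.+1]exprS.
    have : t ^+ n != 0 by rewrite expf_neq0.
    set a := t ^+ n; move: (n%:R : R) => N a0.
    by field; rewrite tn0 a0.
  have N : \forall s \near (t : R^o), f s = expinv n s.
    by near=> s; rewrite /expinv (_ : 0 < s)//; near: s; exact: lt_nbhsr.
  have [df1 df2] := near_eq_is_derive N df.
  have df3 : differentiable (expinv n : R -> R^o) t by apply/derivable1_diffP.
  split=> //; apply/funext => v.
  by rewrite diff1E// derive1E df2.
- subst t; have [] // := @is_diff_quadratic _ R^o R^o (expinv n) 0 ((n.+2)`!%:R).
    by near=> h; rewrite addr0; exact: expinv_quadratic.
  move=> H1 H2; split=> //; rewrite H2; apply/funext => v.
  by rewrite !expinv_le0// mulr0 addr0 mulr0.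
Unshelve. all: by end_near. Qed.

(** The induction on [k] keeps [n] general, since each derivative passes to the indices n+1 and
    n+2. *)
Lemma Ck_expinv (E : normedModType R) k n (U : set E) (h : E -> R^o) : open U ->
  Ck k U h -> Ck k U (fun x => expinv n (h x)).
Proof.
move=> Uo; elim: k n => [|k IH] n hk.
  move=> x Ux; apply: (continuous_comp (hk x Ux)).
  by apply: differentiable_continuous; have [] := is_diff_expinv n (h x).
have [dh Dh] := hk; split.
  move=> x Ux; apply: (@differentiable_comp _ _ _ _ h (expinv n : R^o -> R^o)).
    exact: dh.
  by have [] := is_diff_expinv n (h x).
move=> v; apply: (@Ck_ext _ _ _ _ _ (fun x =>
    'D_v h x * (- n%:R * expinv n.+1 (h x) + expinv n.+2 (h x)) : R^o)) => //.
  move=> x Ux; have [d1 d2] := is_diff_expinv n (h x).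
  have -> : (fun x => expinv n (h x)) = (expinv n : R^o -> R^o) \o h by [].
  rewrite [RHS]deriveE; last by apply: differentiable_comp => //; exact: dh.
  rewrite (@diff_comp _ _ _ _ h (expinv n : R^o -> R^o))//; last exact: dh.
  by rewrite /= d2 deriveE//; exact: dh.
apply: CkM => //; [exact: Dh|]; apply: CkD => //; last by apply: IH; exact: CkS hk.
by apply: CkM => //; [exact: Ck_cst|apply: IH; exact: CkS hk].
Qed.

Lemma Ck_linear (E W : normedModType R) k (U : set E) (f : {linear E -> W}) :
  continuous f -> Ck k U f.
Proof.
case: k => [|k] cf; first by move=> x _; exact: cf.
split=> [x _|v]; first exact: linear_differentiable.
have -> : (fun x => 'D_v f x) = (fun=> f v); last exact: Ck_cst.
by apply/funext => x; rewrite deriveE ?diff_lin//; exact: linear_differentiable.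
Qed.

Lemma Ck_coord_id k n (U : set 'rV[R]_n) i : open U ->
  Ck k U (fun y : 'rV[R]_n => y 0 i : R^o).
Proof.
move=> Uo; apply: (@Ck_coord _ _ _ _ _ id) => //.
by apply: (@Ck_linear _ _ _ _ idfun) => x; exact: cvg_id.
Qed.

(** The function is exp(-1/t) at t = e^2 - |y - x|^2, with the Euclidean norm, normalised at [x].
    [C] is the closed cube of half-side e about [x]: it is compact as a product of segments and
    contains the Euclidean ball of radius e. *)
Lemma bump_function n (U : set 'rV[R]_n) (x : 'rV[R]_n) : open U -> U x ->
  exists (phi : 'rV[R]_n -> R^o) (C : set 'rV[R]_n),
    [/\ smooth_on setT phi, compact C, C `<=` U,
        forall y, ~ C y -> phi y = 0 & phi x = 1].
Proof.
move=> Uo Ux.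
have [/= r r0 rU] : nbhs_ball x U by apply/nbhs_ballP; exact: open_nbhs_nbhs.
(* Balls of ['rV[R]_n] are cubes; half the radius puts the closed cube [C] inside the open one. *)
pose e := r / 2; have e0 : 0 < e by rewrite divr_gt0.
pose h (y : 'rV[R]_n) : R^o := e ^+ 2 + \sum_i (- (y 0 i - x 0 i) * (y 0 i - x 0 i)).
have hx : h x = e ^+ 2.
  by rewrite /h big1 ?addr0// => i _; rewrite subrr mulr0.
have hs k : Ck k setT h.
  apply: CkD; [exact: openT|exact: Ck_cst|].
  have cs i : Ck k setT (fun y : 'rV[R]_n => y 0 i - x 0 i : R^o).
    by apply: CkD; [exact: openT|apply: Ck_coord_id; exact: openT|exact: Ck_cst].
  apply: Ck_sum => [|i]; first exact: openT.
  apply: CkM; [exact: openT| |exact: cs].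
  have -> : (fun y : 'rV[R]_n => - (y 0 i - x 0 i) : R^o) =
            (fun y : 'rV[R]_n => (-1) * (y 0 i - x 0 i) : R^o).
    by apply/funext => y; rewrite mulN1r.
  by apply: CkM; [exact: openT|exact: Ck_cst|exact: cs].
exists (fun y => (expinv 0 (h x))^-1 * expinv 0 (h y)).
exists [set v | forall i, `[x 0 i - e, x 0 i + e]%classic (v ord0 i)].
split.
- move=> k; apply: CkM; [exact: openT|exact: Ck_cst|].
  by apply: Ck_expinv => //; exact: openT.
- apply: (@rV_compact R n (fun i => `[x 0 i - e, x 0 i + e]%classic)) => i.
  exact: segment_compact.
- move=> y Cy; apply: rU; split=> // i j; rewrite (ord1 i); have := Cy j.
  rewrite /= in_itv/= /ball/= => Hj.
  rewrite ltr_norml -[r](divfK (_ : 2 != 0))// -/e; lra.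
- move=> y nC; rewrite (@expinv_le0 0 (h y)) ?mulr0//.
  (* Outside the cube a single coordinate already contributes enough to make [h y] nonpositive. *)
  have [i Hi] : exists i, ~ `[x 0 i - e, x 0 i + e]%classic (y ord0 i).
    by apply/existsNP.
  rewrite /h (bigD1 i)//= addrA.
  have H1 : \sum_(j | j != i) (- (y 0 j - x 0 j) * (y 0 j - x 0 j)) <= 0.
    by apply: sumr_le0 => j _; rewrite mulNr oppr_le0 -expr2 sqr_ge0.
  apply: (le_trans (lerD (lexx _) H1)); rewrite addr0 mulNr subr_le0 -expr2.
  rewrite -[leRHS]real_normK ?num_real// ler_sqr ?nnegrE ?normr_ge0 ?(ltW e0)//.
  rewrite leNgt; apply/negP => Hlt; apply: Hi.
  by move: Hlt; rewrite /= in_itv/= ltr_norml => Hlt; lra.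
- by rewrite mulVf// hx gt_eqF// expinv_gt0// exprn_gt0.
Qed.

End Bump.

(** * Smooth functions and tangent vectors *)

Section ManifoldTheory.
Variables (R : realType) (m : nat) (M : smooth_manifold R m).
Implicit Types (c d : chart R m M) (f h : M -> R) (p q : M).

Local Notation loc c f := ((f \o chart_inv c : 'rV[R]_m -> R^o)).

Lemma smooth_funD f h : smooth_fun f -> smooth_fun h -> smooth_fun (f + h).
Proof.
move=> sf sh c ac k; apply: (CkD (f := loc c f) (g := loc c h)).
- exact: chart_img_open.
- exact: sf.
- exact: sh.
Qed.

Lemma smooth_funM f h : smooth_fun f -> smooth_fun h ->
  smooth_fun (fun p => f p * h p).
Proof.
move=> sf sh c ac k; apply: (CkM (f := loc c f) (g := loc c h)).
- exact: chart_img_open.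
- exact: sf.
- exact: sh.
Qed.

Lemma smooth_fun_cst (a : R) : @smooth_fun R m M (fun=> a).
Proof. by move=> c ac k; exact: (@Ck_cst _ _ R^o). Qed.

Lemma smooth_fun_sum (I : Type) (r : seq I) (P : pred I) (F : I -> M -> R) :
  (forall i, smooth_fun (F i)) -> smooth_fun (fun p => \sum_(i <- r | P i) F i p).
Proof.
move=> sF; elim: r => [|i r IH].
  by under eq_fun do rewrite big_nil; exact: smooth_fun_cst.
under eq_fun do rewrite big_cons.
by case: (P i) => //; exact: smooth_funD.
Qed.

Lemma smooth_fun_prod (I : Type) (r : seq I) (P : pred I) (F : I -> M -> R) :
  (forall i, smooth_fun (F i)) -> smooth_fun (fun p => \prod_(i <- r | P i) F i p).
Proof.
move=> sF; elim: r => [|i r IH].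
  by under eq_fun do rewrite big_nil; exact: smooth_fun_cst.
under eq_fun do rewrite big_cons.
by case: (P i) => //; exact: smooth_funM.
Qed.

Lemma smooth_fun_det n (F : M -> 'M[R]_n) :
  (forall i j, smooth_fun (fun p => F p i j)) -> smooth_fun (fun p => \det (F p)).
Proof.
move=> sF; apply: smooth_fun_sum => s.
by apply: smooth_funM; [exact: smooth_fun_cst|exact: smooth_fun_prod].
Qed.

Lemma smooth_fun_adj n (F : M -> 'M[R]_n) i j :
  (forall i j, smooth_fun (fun p => F p i j)) -> smooth_fun (fun p => (\adj (F p)) i j).
Proof.
move=> sF; under eq_fun do rewrite mxE.
apply: smooth_funM; first exact: smooth_fun_cst.
apply: smooth_fun_det => k l; under eq_fun do rewrite !mxE.
exact: sF.
Qed.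

Lemma smooth_fun_differentiable f c p : atlas c -> chart_dom c p ->
  smooth_fun f -> differentiable (loc c f) (chart_map c p).
Proof.
by move=> ac cp /(_ c ac 1%N) /Ck_differentiable; apply; exists p.
Qed.

Lemma tangent_linear p (v : fnl M) f h (a : R) : tangent p v ->
  smooth_fun f -> smooth_fun h ->
  v (fun p => a * f p + h p) = a * v f + v h.
Proof.
move=> [_ tv] sf sh; have [c ac cp] := atlas_cover p.
have [b vE] := tv c ac cp.
have df := smooth_fun_differentiable ac cp sf.
have dh := smooth_fun_differentiable ac cp sh.
rewrite !vE//; last first.
  apply: smooth_funD => //; apply: smooth_funM => //; exact: smooth_fun_cst.
have -> : loc c (fun p => a * f p + h p) = a *: loc c f + loc c h by [].
rewrite deriveD; [|exact/derivableZ/diff_derivable|exact: diff_derivable].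
by rewrite deriveZ//; exact: diff_derivable.
Qed.

Lemma tangent_cst p (v : fnl M) (a : R) : tangent p v -> v (fun=> a) = 0.
Proof.
move=> [_ tv]; have [c ac cp] := atlas_cover p.
have [b ->] := tv c ac cp; last exact: smooth_fun_cst.
by rewrite (_ : loc c _ = cst (a : R^o))// derive_cst.
Qed.

Lemma tangent_comb p (u v : fnl M) (a : R) :
  tangent p u -> tangent p v -> tangent p (a *: u + v).
Proof.
move=> [u0 tu] [v0 tv]; split.
  by move=> f nf; rewrite !fctE u0// v0// scaler0 addr0.
move=> c ac cp; have [b uE] := tu c ac cp; have [b' vE] := tv c ac cp.
exists (a *: b + b') => f sf; have df := smooth_fun_differentiable ac cp sf.
by rewrite !fctE uE// vE// !deriveE// linearP.
Qed.

Lemma tangent0 p : tangent p (0 : fnl M).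
Proof.
split=> // c ac cp; exists 0 => f sf; by rewrite derive0.
Qed.

(* The coefficient vectors of [m] independent tangent vectors in a chart form an
   invertible matrix. *)
Lemma tangent_basis p n (e : 'I_n -> fnl M) (v : fnl M) : n = m ->
  (forall i, tangent p (e i)) -> lin_free e -> tangent p v ->
  exists a : 'I_n -> R, v = \sum_i a i *: e i.
Proof.
move=> nm; subst n; move=> te fe tv; have [c ac cp] := atlas_cover p.
have /choice[A eE] : forall i, exists a : 'rV[R]_m, forall f, smooth_fun f ->
    e i f = 'D_a (loc c f) (chart_map c p).
  by move=> i; exact: (te i).2.
have [b vE] := tv.2 c ac cp.
pose B := \matrix_(i < m) A i.
have comb (x : 'rV[R]_m) f : smooth_fun f ->
    (\sum_i x 0 i *: e i) f = 'D_(x *m B) (loc c f) (chart_map c p).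
  move=> sf; have df := smooth_fun_differentiable ac cp sf.
  rewrite mulmx_sum_row deriveE// linear_sum fct_sumE.
  apply: eq_bigr => i _; rewrite linearZ/= rowK -deriveE//.
  by rewrite -[RHS]/(x 0 i *: 'D_(A i) (loc c f) (chart_map c p)) -eE.
have Bu : B \in unitmx.
  rewrite -row_free_unit; apply/row_freeP; apply/row_freeP.
  apply: inj_row_free => x xB; apply/rowP => i; rewrite mxE; apply: fe.
  (* On non-smooth functions every tangent vector is 0 by convention, so the content lies in the
     smooth case. *)
  apply/funext => f; case: (pselect (smooth_fun f)) => sf.
    by rewrite comb// xB derive0.
  rewrite fct_sumE big1// => j _; rewrite !fctE (te j).1// scaler0//.
exists (fun i => (b *m invmx B) 0 i); apply/funext => f.
case: (pselect (smooth_fun f)) => sf; first by rewrite comb// mulmxKV// vE.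
rewrite fct_sumE tv.1// big1// => j _; rewrite !fctE (te j).1// scaler0//.
Qed.

Lemma vfieldD (X Y : rough_field M) : vfield X -> vfield Y -> vfield (X + Y).
Proof.
move=> [tX sX] [tY sY]; split.
  by move=> p; rewrite !fctE -[X p]scale1r; exact: tangent_comb.
by move=> f sf; apply: (@smooth_funD (act X f) (act Y f)); [exact: sX|exact: sY].
Qed.

Lemma vfield_fmul f (X : rough_field M) :
  smooth_fun f -> vfield X -> vfield (fmul f X).
Proof.
move=> sf [tX sX]; split.
  by move=> p; rewrite -[fmul _ _ _]addr0; apply: tangent_comb => //; exact: tangent0.
by move=> h sh; apply: (@smooth_funM f (act X h)) => //; exact: sX.
Qed.

Lemma vfieldZ (a : R) (X : rough_field M) : vfield X -> vfield (a *: X).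
Proof. by move=> vX; apply: (@vfield_fmul (fun=> a)) => //; exact: smooth_fun_cst. Qed.

Lemma vfield0 : vfield (0 : rough_field M).
Proof.
split=> [p|f sf]; first exact: tangent0.
exact: smooth_fun_cst.
Qed.

(** * Passage between charts and extension of tangent vectors to fields *)

Lemma open_chart_preimage d (A : set M) : open A ->
  open (chart_map d @` chart_dom d `&` chart_inv d @^-1` A).
Proof.
move=> Ao; rewrite openE => y [Uy Ay].
have U1 : nbhs y (chart_map d @` chart_dom d).
  by apply: open_nbhs_nbhs; split=> //; exact: chart_img_open.
have U2 : nbhs y (chart_inv d @^-1` A).
  by apply: (chart_inv_cont Uy); apply: open_nbhs_nbhs.
exact: filterI.
Qed.

Lemma chart_image_overlapE d c :
  chart_map d @` (chart_dom d `&` chart_dom c) =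
  chart_map d @` chart_dom d `&` chart_inv d @^-1` chart_dom c.
Proof.
apply/seteqP; split=> y.
  move=> [q [dq cq] <-]; split; first by exists q.
  by rewrite /= chart_mapK.
by move=> [[q dq <-]] /=; rewrite chart_mapK// => cq; exists q.
Qed.

Lemma open_chart_overlap d c :
  open (chart_map d @` (chart_dom d `&` chart_dom c)).
Proof.
by rewrite chart_image_overlapE; apply: open_chart_preimage; exact: chart_dom_open.
Qed.

Definition extend_by_zero c (u : 'rV[R]_m -> R) : M -> R :=
  fun q => if `[< chart_dom c q >] then u (chart_map c q) else 0.

(** The image of [C] in the manifold is compact, hence closed by the Hausdorff property. So near
    each point the extension is either [u] after a transition map, or 0 on the open complement of
    that image. *)
Lemma smooth_extend_by_zero c (u : 'rV[R]_m -> R^o) (C : set 'rV[R]_m) :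
  atlas c -> smooth_on (chart_map c @` chart_dom c) u ->
  compact C -> C `<=` chart_map c @` chart_dom c ->
  (forall y, ~ C y -> u y = 0) -> smooth_fun (extend_by_zero c u).
Proof.
move=> ac su cC CU u0 d ad k.
have Kc : closed (chart_inv c @` C).
  apply: compact_closed; first exact: manifold_hausdorff.
  apply: continuous_compact => //; apply: continuous_in_subspaceT => y.
  by rewrite inE => /CU; exact: chart_inv_cont.
apply: Ck_locally => y [q dq qy].
case: (pselect (chart_dom c q)) => cq.
  exists (chart_map d @` (chart_dom d `&` chart_dom c)); first by exists q.
  apply: (@Ck_ext _ _ _ _ _ (u \o (chart_map c \o chart_inv d))).
  - exact: open_chart_overlap.
  - move=> _ [q' [dq' cq'] <-]; rewrite /extend_by_zero /= chart_mapK//.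
    by rewrite asboolT.
  apply: (@Ck_comp _ _ _ _ _ (chart_map c @` chart_dom c)).
  - exact: open_chart_overlap.
  - by move=> _ [q' [dq' cq'] <-]; rewrite /= chart_mapK//; exists q'.
  - exact: atlas_compatible.
  - exact: su.
exists (chart_map d @` chart_dom d `&` chart_inv d @^-1` (~` (chart_inv c @` C))).
  split; first by exists q.
  rewrite /= -qy chart_mapK// => -[z /CU[q' cq' <-]].
  by rewrite chart_mapK// => qq; apply: cq; rewrite -qq.
apply: (@Ck_ext _ _ _ _ _ (fun=> 0)); last exact: Ck_cst.
  by apply: open_chart_preimage; exact: closed_openC.
move=> z [_ /= nK]; rewrite /extend_by_zero; case: asboolP => // cz.
rewrite u0// => Cz; apply: nK; exists (chart_map c (chart_inv d z)) => //.
by rewrite chart_mapK.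
Qed.

(** This is the chain rule for the transition map. The new direction does not depend on [f], as
    [tangent] demands of a coefficient vector. *)
Lemma derive_chart_change c d p (a : 'rV[R]_m) f :
  atlas c -> atlas d -> chart_dom c p -> chart_dom d p -> smooth_fun f ->
  'D_a (loc c f) (chart_map c p) =
  'D_('D_a (chart_map d \o chart_inv c) (chart_map c p)) (loc d f) (chart_map d p).
Proof.
move=> ac ad cp dp sf.
have O := @open_chart_overlap c d.
have Op : (chart_map c @` (chart_dom c `&` chart_dom d)) (chart_map c p) by exists p.
rewrite (@near_eq_derive _ _ _ _ (loc d f \o (chart_map d \o chart_inv c))).
  rewrite derive_comp_rV/= ?chart_mapK//; last exact: smooth_fun_differentiable.
  have /Ck_differentiable := @atlas_compatible _ _ _ c d ac ad 1%N; exact.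
apply: filterS (open_nbhs_nbhs (conj O Op)) => _ [q [cq dq] <-].
by rewrite /= !chart_mapK.
Qed.

(** The extension has constant coefficients [a] in one chart, multiplied by a bump function and
    continued by zero. *)
Lemma tangent_extension p (v : fnl M) : tangent p v ->
  exists2 X : rough_field M, vfield X & X p = v.
Proof.
move=> [v0 tv]; have [c ac cp] := atlas_cover p.
have [a vE] := tv c ac cp.
have cUp : (chart_map c @` chart_dom c) (chart_map c p) by exists p.
have [phi [C [sphi cC CU phi0 phi1]]] :=
  bump_function (@chart_img_open _ _ _ c) cUp.
pose u f y : R^o := phi y * 'D_a (loc c f) y.
pose X : rough_field M := fun q f =>
  if `[< smooth_fun f >] then extend_by_zero c (u f) q else 0.
exists X; last first.
  apply/funext => f; rewrite /X; case: asboolP => sf; last by rewrite v0.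
  by rewrite /extend_by_zero asboolT// /u phi1 mul1r vE.
split.
  move=> q; split; first by move=> f nf; rewrite /X asboolF.
  (* Outside the chart [c] the coefficient vector is 0; inside it is [a] carried over by the
     transition map and scaled by the bump. *)
  move=> d ad dq; case: (pselect (chart_dom c q)) => cq; last first.
    exists 0 => f sf; rewrite derive0 /X asboolT//.
    by rewrite /extend_by_zero asboolF.
  exists (phi (chart_map c q) *: 'D_a (chart_map d \o chart_inv c) (chart_map c q)).
  move=> f sf; rewrite /X asboolT// /extend_by_zero asboolT// /u.
  rewrite (derive_chart_change _ ac ad)//.
  move: ('D_a (_ \o _) _) => w.
  have df := smooth_fun_differentiable ad dq sf.
  by rewrite !(deriveE _ df) linearZ.
move=> f sf; have -> : act X f = extend_by_zero c (u f).
  by apply/funext => q; rewrite /act /X asboolT.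
apply: (@smooth_extend_by_zero _ _ C) => //.
  move=> k; apply: CkM; first exact: chart_img_open.
    exact: Ck_subset (sphi k).
  by apply: Ck_derive; exact: sf.
by move=> y nC; rewrite /u phi0// mul0r.
Qed.

End ManifoldTheory.

(** * The module of vector fields *)

Section Fields.
Variables (R : realType) (m : nat) (M : smooth_manifold R m).

Definition vfield_pred : {pred rough_field M} := fun X => `[< vfield X >].

Fact vfield_pred_submod : submod_closed vfield_pred.
Proof.
split; first by rewrite unfold_in; apply/asboolP; exact: vfield0.
move=> a X Y; rewrite !unfold_in => /asboolP vX /asboolP vY; apply/asboolP.
by apply: vfieldD => //; exact: vfieldZ.
Qed.

HB.instance Definition _ :=
  GRing.isSubmodClosed.Build R (rough_field M) vfield_pred vfield_pred_submod.

(** Bundling smoothness with the field gives a real module, in which linear identities and big sums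
    need no smoothness side conditions. *)
Definition vfieldT : Type := {X : rough_field M | X \in vfield_pred}.
HB.instance Definition _ := SubChoice.on vfieldT.
HB.instance Definition _ := [SubChoice_isSubLmodule of vfieldT by <:].

Implicit Types (X Y Z : vfieldT) (p : M).

Lemma vfieldTP X : vfield (val X).
Proof. by apply/asboolP; have := valP X; rewrite unfold_in. Qed.

Definition mk_vfieldT (X : rough_field M) (vX : vfield X) : vfieldT :=
  exist _ X (asboolT vX).

Lemma vfieldT_ext X Y : (forall p f, val X p f = val Y p f) -> X = Y.
Proof. by move=> XY; apply: val_inj; apply/funext => p; apply/funext => f. Qed.

Lemma val_sub X Y p : val (X - Y) p = val X p - val Y p.
Proof. by []. Qed.
Lemma evD X Y p f : val (X + Y) p f = val X p f + val Y p f.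
Proof. by []. Qed.
Lemma evN X p f : val (- X) p f = - val X p f.
Proof. by []. Qed.
Lemma ev0 p f : val (0 : vfieldT) p f = 0.
Proof. by []. Qed.

Lemma val_inj0 X : (forall p, val X p = 0) -> X = 0.
Proof. by move=> X0; apply: vfieldT_ext => p f; rewrite X0. Qed.

Definition fsmul f (sf : smooth_fun f) X : vfieldT :=
  mk_vfieldT (vfield_fmul sf (vfieldTP X)).

Lemma ev_fsmul f (sf : smooth_fun f) X p h : val (fsmul sf X) p h = f p * val X p h.
Proof. by []. Qed.

Lemma fsmul_cst (a : R) X : fsmul (smooth_fun_cst a) X = a *: X.
Proof. exact: val_inj. Qed.

Lemma val_sum n (a : 'I_n -> R) (F : 'I_n -> vfieldT) p :
  val (\sum_i a i *: F i) p = \sum_i a i *: val (F i) p.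
Proof.
apply: (big_ind2 (fun (X : vfieldT) v => val X p = v)) => // X u Y v <- <-.
by [].
Qed.

Variable g : metric M.
Hypothesis sg : semi_riemannian g.

Definition field_inner X Y p : R := g p (val X p) (val Y p).

Lemma tangent_val X p : tangent p (val X p).
Proof. by have [] := vfieldTP X. Qed.
Hint Resolve tangent_val : core.

Lemma ipC X Y p : field_inner X Y p = field_inner Y X p.
Proof. by case: sg => _ H _ _ _; apply: H. Qed.

Lemma ip_lin X Y Z a p :
  field_inner (X + a *: Y) Z p = field_inner X Z p + a * field_inner Y Z p.
Proof.
case: sg => H _ _ _ _; rewrite addrC [RHS]addrC.
exact: (H p a (val Y p) (val X p) (val Z p)).
Qed.

Lemma ipD X Y Z p : field_inner (X + Y) Z p = field_inner X Z p + field_inner Y Z p.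
Proof. by rewrite -[Y]scale1r ip_lin mul1r scale1r. Qed.

Lemma ip0 Z p : field_inner 0 Z p = 0.
Proof. by have := ipD 0 0 Z p; rewrite addr0 => /eqP; rewrite -subr_eq subrr => /eqP. Qed.

Lemma ipZ a X Z p : field_inner (a *: X) Z p = a * field_inner X Z p.
Proof. by rewrite -[a *: X]add0r ip_lin ip0 add0r. Qed.

Lemma ipN X Z p : field_inner (- X) Z p = - field_inner X Z p.
Proof. by rewrite -scaleN1r ipZ mulN1r. Qed.

Lemma ipB X Y Z p : field_inner (X - Y) Z p = field_inner X Z p - field_inner Y Z p.
Proof. by rewrite ipD ipN. Qed.

(** Nondegeneracy tests against all tangent vectors at [p]; smooth fields suffice because every
    tangent vector extends to one. *)
Lemma ip_eq0 X p : (forall Y, field_inner X Y p = 0) -> val X p = 0.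
Proof.
case: sg => _ _ H _ _ X0; apply: (H p) => // v tv.
have [Y vY <-] := tangent_extension tv.
exact: (X0 (mk_vfieldT vY)).
Qed.

Lemma ip_neq0 X p : val X p <> 0 -> exists Y, field_inner Y X p != 0.
Proof.
move=> X0; apply: contrapT => nY; apply: X0; apply: ip_eq0 => Y.
by rewrite ipC; apply/eqP/negP => /negP ?; apply: nY; exists Y.
Qed.

Lemma smooth_ip X Y : smooth_fun (field_inner X Y).
Proof. by case: sg => _ _ _ H _; apply: H; exact: vfieldTP. Qed.

(** * Evaluation of tensors at a point by means of a frame *)

Section Tensoriality.
Variables (n : nat) (E : 'I_n -> vfieldT) (nm : n = m).

Definition gram p : 'M[R]_n := \matrix_(i, j) field_inner (E i) (E j) p.

Lemma ip_comb (c : 'rV[R]_n) p j :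
  field_inner (\sum_i c 0 i *: E i) (E j) p = (c *m gram p) 0 j.
Proof.
rewrite mxE (_ : field_inner _ _ p = \sum_i c 0 i * field_inner (E i) (E j) p).
  by apply: eq_bigr => i _; rewrite mxE.
apply: (big_ind2 (fun X a => field_inner X (E j) p = a)); first exact: ip0.
  by move=> X a Y b <- <-; rewrite ipD.
by move=> i _; rewrite ipZ.
Qed.

(** A row in the kernel of the Gram matrix is a combination orthogonal to the frame, hence to every
    tangent vector. Nondegeneracy of [g] makes the combination 0, and freeness makes its
    coefficients 0. *)
Lemma frame_gram p : lin_free (fun i => val (E i) p) -> \det (gram p) != 0.
Proof.
move=> fE; rewrite -unitfE -[_ \is a _]/(gram p \in unitmx) -row_free_unit.
apply: inj_row_free => x xB; apply/rowP => i; rewrite mxE.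
apply: (fE (fun i => x 0 i)) => {i}; rewrite -val_sum.
apply: ip_eq0 => Y.
have [a YE] := tangent_basis nm (fun i => tangent_val (E i) p) fE (tangent_val Y p).
have -> : field_inner (\sum_i x 0 i *: E i) Y p =
    field_inner (\sum_i a i *: E i) (\sum_i x 0 i *: E i) p.
  by rewrite ipC /field_inner !val_sum YE.
apply: (big_ind (fun Z => field_inner Z (\sum_i x 0 i *: E i) p = 0)); first exact: ip0.
  by move=> Z W Z0 W0; rewrite ipD Z0 W0 addr0.
by move=> j _; rewrite ipZ ipC ip_comb xB mxE mulr0.
Qed.

Lemma gram_frame p : \det (gram p) != 0 -> lin_free (fun i => val (E i) p).
Proof.
move=> d0 c c0 i; pose x : 'rV[R]_n := \row_i c i.
have uB : gram p \in unitmx by rewrite unitmxE unitfE.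
suff x0 : x = 0 by have := congr1 (fun y : 'rV[R]_n => y 0 i) x0; rewrite !mxE.
rewrite -[x](mulmxK uB) (_ : x *m gram p = 0) ?mul0mx//.
apply/rowP => j; rewrite -ip_comb mxE /field_inner val_sum.
under eq_bigr do rewrite mxE.
by rewrite c0 -[RHS](ip0 (E j) p).
Qed.

(** Where [E] is a frame, Cramer's rule makes this det^2 times the [i]-th coefficient of [X]. With
    the adjugate in place of the inverse it is smooth on the whole manifold. *)
Definition gram_coef X i q : R :=
  \det (gram q) * \sum_j field_inner X (E j) q * \adj (gram q) j i.

Lemma smooth_det_gram : smooth_fun (fun q => \det (gram q)).
Proof.
apply: smooth_fun_det => i j; under eq_fun do rewrite mxE.
exact: smooth_ip.
Qed.

Lemma smooth_gram_coef X i : smooth_fun (gram_coef X i).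
Proof.
apply: smooth_funM; first exact: smooth_det_gram.
apply: smooth_fun_sum => j; apply: smooth_funM; first exact: smooth_ip.
apply: smooth_fun_adj => k l; under eq_fun do rewrite mxE.
exact: smooth_ip.
Qed.

(* The factor [det ^+ 2] makes this identity hold also where [E] is not a frame. *)
Lemma gram_expansion X :
  fsmul (smooth_funM smooth_det_gram smooth_det_gram) X =
  \sum_i fsmul (smooth_gram_coef X i) (E i).
Proof.
apply: val_inj; apply/funext => q.
have -> : val (\sum_i fsmul (smooth_gram_coef X i) (E i)) q =
    \sum_i gram_coef X i q *: val (E i) q.
  by apply: (big_ind2 (fun (Y : vfieldT) v => val Y q = v)) => // Y u Z v <- <-.
rewrite /= /fmul; have [d0|d0] := eqVneq (\det (gram q)) 0.
  by rewrite /gram_coef d0 mul0r scale0r big1// => i _; rewrite mul0r scale0r.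
have fE := gram_frame d0.
have [a XE] := tangent_basis nm (fun i => tangent_val (E i) q) fE (tangent_val X q).
pose x : 'rV[R]_n := \row_i a i.
rewrite [val X q]XE scaler_sumr; apply: eq_bigr => i _; rewrite scalerA.
congr (_ *: _); rewrite /gram_coef -mulrA; congr (_ * _).
have -> : \sum_j field_inner X (E j) q * (\adj (gram q)) j i =
    (x *m gram q *m \adj (gram q)) 0 i.
  rewrite [RHS]mxE; apply: eq_bigr => j _; congr (_ * _).
  rewrite -ip_comb /field_inner val_sum XE; congr (g _ _ _).
  by apply: eq_bigr => k _; rewrite mxE.
by rewrite -mulmxA mul_mx_adj mul_mx_scalar !mxE.
Qed.

(** Applying [T] to [gram_expansion] writes det^2 T(X) through the fields T(E i), with coefficients
    that vanish wherever [X] does; at [p] the determinant is invertible. The expansion is global, so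
    [T] need not be localised. *)
Lemma tensor_at0 (T : vfieldT -> vfieldT) p :
  lin_free (fun i => val (E i) p) ->
  (forall X Y, T (X + Y) = T X + T Y) ->
  (forall f (sf : smooth_fun f) X, T (fsmul sf X) = fsmul sf (T X)) ->
  forall X, val X p = 0 -> val (T X) p = 0.
Proof.
move=> fE TD TM X X0; have d0 := frame_gram fE.
have T0 : T 0 = 0 by apply: (addrI (T 0)); rewrite -TD !addr0.
have := congr1 (fun Y => val (T Y) p) (gram_expansion X); rewrite /= TM.
have -> : T (\sum_i fsmul (smooth_gram_coef X i) (E i)) =
    \sum_i fsmul (smooth_gram_coef X i) (T (E i)).
  by apply: (big_ind2 (fun Y Z => T Y = Z)) => // Y u Z v <- <-; rewrite TD.
have -> : val (\sum_i fsmul (smooth_gram_coef X i) (T (E i))) p =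
    \sum_i gram_coef X i p *: val (T (E i)) p.
  by apply: (big_ind2 (fun (Y : vfieldT) v => val Y p = v)) => // Y u Z v <- <-.
rewrite [RHS]big1 => [|i _]; last first.
  rewrite /gram_coef big1 ?mulr0 ?scale0r// => j _.
  have -> : field_inner X (E j) p = 0 by rewrite /field_inner X0; exact: (ip0 (E j) p).
  by rewrite mul0r.
move/eqP; rewrite scaler_eq0 mulf_eq0 orbb (negPf d0)/=.
by move/eqP.
Qed.

Lemma tensor_at (T : vfieldT -> vfieldT) p :
  lin_free (fun i => val (E i) p) ->
  (forall X Y, T (X + Y) = T X + T Y) ->
  (forall f (sf : smooth_fun f) X, T (fsmul sf X) = fsmul sf (T X)) ->
  forall X Y, val X p = val Y p -> val (T X) p = val (T Y) p.
Proof.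
move=> fE TD TM X Y XY; apply: subr0_eq; rewrite -val_sub.
have -> : T X - T Y = T (X - Y) by apply/eqP; rewrite subr_eq -TD subrK.
by apply: (tensor_at0 fE TD TM); rewrite val_sub XY subrr.
Qed.

End Tensoriality.
End Fields.

(** * Connection, curvature and Killing fields *)

Lemma subr3ACA (U : zmodType) (a b c d a' b' c' d' : U) :
  (a + a') - (b + b') - (c + c') - (d + d') =
  (a - b - c - d) + (a' - b' - c' - d').
Proof. by rewrite !opprD (addrACA a) (addrACA (a - b)) (addrACA (a - b - c)). Qed.

Section Connection.
Variables (R : realType) (m : nat) (M : smooth_manifold R m).
Variables (g : metric M) (nabla : rough_field M -> rough_field M -> rough_field M).
Hypotheses (sg : semi_riemannian g) (lc : levi_civita g nabla).

Local Notation VF := (vfieldT M).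
Implicit Types (X Y Z T W L : VF) (p : M).
Local Notation ip := (field_inner g).

Lemma ipBr X Y Z p : ip X (Y - Z) p = ip X Y p - ip X Z p.
Proof. by rewrite (ipC sg) (ipB sg) !(ipC sg X). Qed.

Fact cov_subproof X Y : vfield (nabla (val X) (val Y)).
Proof. by case: lc => -[H _ _ _ _] _ _; apply: H; exact: vfieldTP. Qed.
Definition covd X Y : VF := mk_vfieldT (cov_subproof X Y).

(** This is the Lie bracket in its torsion-free form, which is a smooth field by construction;
    [val_lie] identifies it with [bracket]. *)
Definition lieb X Y : VF := covd X Y - covd Y X.

Lemma covDl X Y Z : covd (X + Y) Z = covd X Z + covd Y Z.
Proof.
case: lc => -[_ H _ _ _] _ _; apply: val_inj.
exact: (H _ _ _ (vfieldTP X) (vfieldTP Y) (vfieldTP Z)).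
Qed.

Lemma covDr X Y Z : covd X (Y + Z) = covd X Y + covd X Z.
Proof.
case: lc => -[_ _ _ H _] _ _; apply: val_inj.
exact: (H _ _ _ (vfieldTP X) (vfieldTP Y) (vfieldTP Z)).
Qed.

Lemma cov_fsmul f (sf : smooth_fun f) X Y : covd (fsmul sf X) Y = fsmul sf (covd X Y).
Proof. by case: lc => -[_ _ H _ _] _ _; apply: val_inj; apply: H => //; exact: vfieldTP. Qed.

Lemma smooth_act f X : smooth_fun f -> smooth_fun (act (val X) f).
Proof. by case: (vfieldTP X) => _; exact. Qed.

Lemma cov_leibniz f (sf : smooth_fun f) X Y :
  covd X (fsmul sf Y) = fsmul (smooth_act X sf) Y + fsmul sf (covd X Y).
Proof.
by case: lc => -[_ _ _ _ H] _ _; apply: val_inj; apply: H => //; exact: vfieldTP.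
Qed.

Lemma covZl a X Y : covd (a *: X) Y = a *: covd X Y.
Proof. by rewrite -fsmul_cst cov_fsmul fsmul_cst. Qed.

Lemma covZr a X Y : covd X (a *: Y) = a *: covd X Y.
Proof.
rewrite -fsmul_cst cov_leibniz fsmul_cst -[RHS]add0r; congr (_ + _).
apply: vfieldT_ext => p f.
by rewrite ev_fsmul /act (tangent_cst a (tangent_val X p)) mul0r.
Qed.

Lemma cov0l X : covd 0 X = 0. Proof. by rewrite -(scale0r 0) covZl !scale0r. Qed.
Lemma cov0r X : covd X 0 = 0. Proof. by rewrite -(scale0r 0) covZr !scale0r. Qed.
Lemma covNl X Y : covd (- X) Y = - covd X Y.
Proof. by rewrite -scaleN1r covZl scaleN1r. Qed.
Lemma covNr X Y : covd X (- Y) = - covd X Y.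
Proof. by rewrite -scaleN1r covZr scaleN1r. Qed.
Lemma covBl X Y Z : covd (X - Y) Z = covd X Z - covd Y Z.
Proof. by rewrite covDl covNl. Qed.
Lemma covBr X Y Z : covd X (Y - Z) = covd X Y - covd X Z.
Proof. by rewrite covDr covNr. Qed.

Lemma val_lie X Y : val (lieb X Y) = bracket (val X) (val Y).
Proof. by case: lc => _ H _; apply: H; exact: vfieldTP. Qed.

Lemma act_ip X Y Z p : act (val X) (ip Y Z) p = ip (covd X Y) Z p + ip Y (covd X Z) p.
Proof.
case: lc => _ _ H.
by have /(congr1 (fun f => f p)) := H _ _ _ (vfieldTP X) (vfieldTP Y) (vfieldTP Z).
Qed.

Lemma act_comb X p f h (a : R) : smooth_fun f -> smooth_fun h ->
  act (val X) (fun q => a * f q + h q) p = a * act (val X) f p + act (val X) h p.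
Proof. exact: tangent_linear (tangent_val X p). Qed.

Lemma actD X p f h : smooth_fun f -> smooth_fun h ->
  act (val X) (fun q => f q + h q) p = act (val X) f p + act (val X) h p.
Proof.
move=> sf sh; have := act_comb X p 1 sf sh; rewrite mul1r => <-.
by congr (act _ _ p); apply/funext => q; rewrite mul1r.
Qed.

Lemma act_cst X p (a : R) : act (val X) (fun=> a) p = 0.
Proof. exact: tangent_cst (tangent_val X p). Qed.

Lemma act_lie X Y f p :
  act (val (lieb X Y)) f p =
  act (val X) (act (val Y) f) p - act (val Y) (act (val X) f) p.
Proof. by rewrite val_lie. Qed.

Lemma jacobi X Y Z : lieb X (lieb Y Z) = lieb (lieb X Y) Z + lieb Y (lieb X Z).
Proof.
apply: vfieldT_ext => p f.
rewrite -[RHS]/(val (lieb (lieb X Y) Z) p f + val (lieb Y (lieb X Z)) p f).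
have e (A B : VF) (h : M -> R) q : val (lieb A B) q h =
  val A q (act (val B) h) - val B q (act (val A) h) by exact: act_lie.
have e2 (A B : VF) (h : M -> R) : act (val (lieb A B)) h =
  (fun q => (-1) * act (val B) (act (val A) h) q + act (val A) (act (val B) h) q).
  by apply/funext => q; rewrite act_lie mulN1r addrC.
(* Expanding a bracket inside a bracket uses linearity of tangent vectors, available on smooth
   functions; on the others all terms are 0. *)
case: (pselect (smooth_fun f)) => sf; last first.
  by rewrite !((tangent_val _ p).1 f sf) addr0.
have ss (A B : VF) : smooth_fun (act (val A) (act (val B) f)).
  by do 2 apply: smooth_act.
have e3 (A B D : VF) : val A p (act (val (lieb B D)) f) =
   val A p (act (val B) (act (val D) f)) - val A p (act (val D) (act (val B) f)).
  rewrite e2 -[LHS]/(act _ _ p) act_comb; [|exact: ss|exact: ss].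
  by rewrite mulN1r addrC.
rewrite (e X (lieb Y Z)) (e (lieb X Y) Z) (e Y (lieb X Z)) !e3 !e; ring.
Qed.

(** * The curvature tensor and its covariant derivative *)

Definition Rm X Y Z : VF := covd X (covd Y Z) - covd Y (covd X Z) - covd (lieb X Y) Z.

Lemma val_Riem X Y Z : val (Rm X Y Z) = curv nabla (val X) (val Y) (val Z).
Proof. by rewrite /curv -val_lie. Qed.

Lemma Riem_skew X Y Z : Rm X Y Z = - Rm Y X Z.
Proof.
by rewrite /Rm /lieb !covBl; apply: vfieldT_ext => p f; rewrite !(evD, evN); ring.
Qed.

Lemma RiemDl X X' Y Z : Rm (X + X') Y Z = Rm X Y Z + Rm X' Y Z.
Proof.
rewrite /Rm /lieb !(covDl, covDr, covNl).
by apply: vfieldT_ext => p f; rewrite !(evD, evN); ring.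
Qed.

Lemma RiemDr X Y Z Z' : Rm X Y (Z + Z') = Rm X Y Z + Rm X Y Z'.
Proof.
rewrite /Rm /lieb !(covDl, covDr, covNl).
by apply: vfieldT_ext => p f; rewrite !(evD, evN); ring.
Qed.

Lemma Riem_fsmul f (sf : smooth_fun f) X Y Z : Rm (fsmul sf X) Y Z = fsmul sf (Rm X Y Z).
Proof.
rewrite /Rm /lieb !(covBl, cov_fsmul, cov_leibniz, covDl).
by apply: vfieldT_ext => p h; rewrite !(evD, evN, ev_fsmul); ring.
Qed.

(** The second-order terms X(Y f) - Y(X f) cancel against [X, Y] f, and the products of first
    derivatives cancel in pairs. *)
Lemma Riem_fsmul3 f (sf : smooth_fun f) X Y Z : Rm X Y (fsmul sf Z) = fsmul sf (Rm X Y Z).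
Proof.
rewrite /Rm !(cov_leibniz, covDr, cov_fsmul).
apply: vfieldT_ext => p h; rewrite !(evD, evN, ev_fsmul) act_lie; ring.
Qed.

Lemma RiemZl a X Y Z : Rm (a *: X) Y Z = a *: Rm X Y Z.
Proof. by rewrite -fsmul_cst Riem_fsmul fsmul_cst. Qed.

Lemma RiemZr a X Y Z : Rm X Y (a *: Z) = a *: Rm X Y Z.
Proof. by rewrite -fsmul_cst Riem_fsmul3 fsmul_cst. Qed.

Lemma RiemDm X Y Y' Z : Rm X (Y + Y') Z = Rm X Y Z + Rm X Y' Z.
Proof. by rewrite Riem_skew RiemDl opprD -!Riem_skew. Qed.

Lemma Riem_fsmul2 f (sf : smooth_fun f) X Y Z : Rm X (fsmul sf Y) Z = fsmul sf (Rm X Y Z).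
Proof.
rewrite Riem_skew Riem_fsmul [in RHS]Riem_skew.
by apply: vfieldT_ext => p h; rewrite !(evN, ev_fsmul) mulrN.
Qed.

(** Let [X, Y] = XY - YX act on the function g(Z, W). Metric compatibility expands both sides, and
    the products of first derivatives cancel. *)
Lemma Riem_skew_adj X Y Z W p : ip (Rm X Y Z) W p = - ip Z (Rm X Y W) p.
Proof.
have key (A B : VF) : act (val A) (act (val B) (ip Z W)) p =
    ip (covd A (covd B Z)) W p + ip (covd B Z) (covd A W) p
    + (ip (covd A Z) (covd B W) p + ip Z (covd A (covd B W)) p).
  have -> : act (val B) (ip Z W) = (fun q => ip (covd B Z) W q + ip Z (covd B W) q).
    by apply/funext => q; rewrite act_ip.
  by rewrite actD; [rewrite !act_ip|exact: (smooth_ip sg)|exact: (smooth_ip sg)].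
have := act_lie X Y (ip Z W) p; rewrite !key act_ip /Rm => H.
rewrite !(ipB sg) ![ip Z _ p](ipC sg) !(ipB sg) ![ip _ Z p](ipC sg).
lra.
Qed.

Definition dRm X Y Z T : VF :=
  covd X (Rm Y Z T) - Rm (covd X Y) Z T - Rm Y (covd X Z) T - Rm Y Z (covd X T).

Lemma val_dRiem X Y Z T :
  val (dRm X Y Z T) = nabla_curv nabla (val X) (val Y) (val Z) (val T).
Proof.
rewrite /nabla_curv -[nabla (val X) (val Y)]/(val (covd X Y)).
rewrite -[nabla (val X) (val Z)]/(val (covd X Z)).
rewrite -[nabla (val X) (val T)]/(val (covd X T)).
rewrite -(val_Riem Y Z T) -(val_Riem (covd X Y) Z T) -(val_Riem Y (covd X Z) T).
by rewrite -(val_Riem Y Z (covd X T)).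
Qed.

Lemma dRiem_fsmul f (sf : smooth_fun f) X Y Z T :
  dRm (fsmul sf X) Y Z T = fsmul sf (dRm X Y Z T).
Proof.
rewrite /dRm !cov_fsmul Riem_fsmul Riem_fsmul2 Riem_fsmul3.
by apply: vfieldT_ext => p h; rewrite !(evD, evN, ev_fsmul); ring.
Qed.

Lemma dRiemDl X X' Y Z T : dRm (X + X') Y Z T = dRm X Y Z T + dRm X' Y Z T.
Proof. by rewrite /dRm !covDl RiemDl RiemDm RiemDr subr3ACA. Qed.

Lemma dRiem_skew X Y Z T : dRm X Y Z T = - dRm X Z Y T.
Proof.
rewrite /dRm (Riem_skew Y Z T) (Riem_skew (covd X Y) Z T) (Riem_skew Y (covd X Z) T).
rewrite (Riem_skew Y Z (covd X T)) covNr.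
by apply: vfieldT_ext => p h; rewrite !(evD, evN); ring.
Qed.

Lemma dRiemZ a X Y Y' Z T : dRm X (Y + a *: Y') Z T = dRm X Y Z T + a *: dRm X Y' Z T.
Proof.
by rewrite /dRm !(covDr, RiemDl, covZr, RiemZl) subr3ACA -!scalerBr.
Qed.

(** * Killing fields and their Lie derivatives *)

Definition is_killing L := forall X Y p, ip (covd X L) Y p + ip X (covd Y L) p = 0.

Lemma killing_ip L X Y p : is_killing L -> ip (covd X L) Y p = - ip X (covd Y L) p.
Proof. by move=> kL; apply/eqP; rewrite -addr_eq0 kL. Qed.

(** This is the vanishing of the Lie derivative of [g]: the Killing equation cancels the terms by
    which [lieb L] differs from [covd L]. *)
Lemma act_ip_killing L X Y p : is_killing L ->
  act (val L) (ip X Y) p = ip (lieb L X) Y p + ip X (lieb L Y) p.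
Proof.
move=> kL; have := kL X Y p; rewrite act_ip /lieb (ipB sg).
by rewrite ![ip X _ p](ipC sg) (ipB sg) => ?; lra.
Qed.

Lemma eq_vfieldT_ip X Y : (forall Z p, ip X Z p = ip Y Z p) -> X = Y.
Proof.
move=> XY; apply: subr0_eq; apply: val_inj0 => p.
by apply: (ip_eq0 sg) => Z; rewrite (ipB sg) XY subrr.
Qed.

(* The defect of this identity is symmetric in [X] and [Y] by the Jacobi
   identity, and its pairing with [Z] is skew in [Y] and [Z]; a 3-tensor with
   both symmetries vanishes. *)
Lemma killing_affine L X Y : is_killing L ->
  lieb L (covd X Y) = covd (lieb L X) Y + covd X (lieb L Y).
Proof.
move=> kL.
pose A X Y := lieb L (covd X Y) - covd (lieb L X) Y - covd X (lieb L Y).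
have Asym X' Y' : A X' Y' = A Y' X'.
  have := jacobi L X' Y'; rewrite /A {1 2 4}/lieb -/(lieb L X') -/(lieb L Y') covBr covBl.
  move=> J; apply: vfieldT_ext => p f.
  have := congr1 (fun u : VF => val u p f) J.
  rewrite /lieb !(evD, evN, covBl, covBr) => ?; lra.
have Askew X' Y' Z' p : ip (A X' Y') Z' p = - ip Y' (A X' Z') p.
  (* Skewness comes from letting [L, X'] = L X' - X' L act on g(Y', Z'): [L] passes through the
     metric by Lie brackets and [X'] by covariant derivatives. *)
  have := act_lie L X' (ip Y' Z') p.
  have -> : act (val L) (ip Y' Z') = (fun q => ip (lieb L Y') Z' q + ip Y' (lieb L Z') q).
    by apply/funext => q; rewrite act_ip_killing.
  have -> : act (val X') (ip Y' Z') = (fun q => ip (covd X' Y') Z' q + ip Y' (covd X' Z') q).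
    by apply/funext => q; rewrite act_ip.
  rewrite !actD; try exact: smooth_ip.
  rewrite !(act_ip_killing _ _ _ kL) !act_ip /A /lieb !(covBl, covBr).
  by rewrite !(ipB sg, ipBr) => ?; lra.
have A0 X' Y' : A X' Y' = 0.
  apply: eq_vfieldT_ip => Z' p; rewrite (ip0 sg).
  have h1 := Askew X' Y' Z' p; have h2 := Askew Z' X' Y' p; have h3 := Askew Y' Z' X' p.
  move: h1 h2 h3; rewrite ![ip _ (A _ _) p](ipC sg).
  rewrite (Asym Z' X') (Asym Y' Z') (Asym Y' X') => *; lra.
have := A0 X Y; rewrite /A => /eqP.
by rewrite -addrA -opprD subr_eq0 => /eqP.
Qed.

(** Curvature is built from [covd] and [lieb], and [lieb L] acts as a derivation on the first by
    [killing_affine] and on the second by the Jacobi identity. *)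
Lemma killing_lie_Riem L Y Z T : is_killing L ->
  lieb L (Rm Y Z T) = Rm (lieb L Y) Z T + Rm Y (lieb L Z) T + Rm Y Z (lieb L T).
Proof.
move=> kL.
have brB (A B : VF) : lieb L (A - B) = lieb L A - lieb L B.
  rewrite /lieb covBr covBl; apply: vfieldT_ext => p f; rewrite !(evD, evN); ring.
have -> : lieb L (Rm Y Z T) =
    lieb L (covd Y (covd Z T)) - lieb L (covd Z (covd Y T))
    - lieb L (covd (lieb Y Z) T).
  by rewrite /Rm !brB.
rewrite !(killing_affine _ _ kL) jacobi /Rm !(covDr, covDl).
by apply: vfieldT_ext => p f; rewrite !(evD, evN); ring.
Qed.

(** Substitute [L, X] = [covd L X - covd X L] in [killing_lie_Riem]: the derivatives along [L] form
    [dRm L], and the rest is the action of the endomorphism X -> [covd X L] on the curvature. *)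
Lemma killing_dRiem L Y Z T : is_killing L ->
  dRm L Y Z T = covd (Rm Y Z T) L - Rm (covd Y L) Z T - Rm Y (covd Z L) T - Rm Y Z (covd T L).
Proof.
move=> kL; have := killing_lie_Riem Y Z T kL.
have CN1 (A B D : VF) : Rm (- A) B D = - Rm A B D by rewrite -scaleN1r RiemZl scaleN1r.
have CN2 (A B D : VF) : Rm A (- B) D = - Rm A B D by rewrite Riem_skew CN1 -Riem_skew.
have CN3 (A B D : VF) : Rm A B (- D) = - Rm A B D by rewrite -scaleN1r RiemZr scaleN1r.
rewrite /dRm {1 2 3 4}/lieb !(RiemDl, RiemDm, RiemDr, CN1, CN2, CN3).
move=> J; apply: vfieldT_ext => p f.
have := congr1 (fun u : VF => val u p f) J; rewrite !(evD, evN) => ?; lra.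
Qed.

End Connection.

(** * Null distributions spanned by commuting Killing fields *)

Section NullDistribution.
Variables (R : realType) (m : nat) (M : smooth_manifold R m).
Variables (g : metric M) (nabla : rough_field M -> rough_field M -> rough_field M).
Hypotheses (sg : semi_riemannian g) (lc : levi_civita g nabla).

Local Notation VF := (vfieldT M).
Local Notation ip := (field_inner g).
Local Notation cov := (covd lc).
Local Notation lie := (lieb lc).
Local Notation Riem := (Rm lc).
Local Notation dRiem := (dRm lc).
Local Notation Killing := (is_killing lc).
Implicit Types (X Y Z T W K L N : VF) (p : M).

(* [KK] stands for the real span of the given Killing fields. *)
Variables (KK : VF -> Prop) (V : VF).
Hypothesis KK_killing : forall L, KK L -> Killing L.
Hypothesis KK_comm : forall K L, KK K -> KK L -> lie K L = 0.
Hypothesis KK_V : KK V.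
Hypothesis KK_perp : forall K p, KK K -> ip K V p = 0.
Hypothesis V_neq0 : forall p, val V p <> 0.
Hypothesis perp_KK : forall X p, ip X V p = 0 ->
  exists2 K, KK K & val K p = val X p.
Hypothesis frame_at : forall p, exists n (E : 'I_n -> VF),
  n = m /\ lin_free (fun i => val (E i) p).

Let perp X p := ip X V p = 0.
(** By [vertE] these are the multiples of [V] at [p]. *)
Let vert X p := forall Y, perp Y p -> ip X Y p = 0.

Lemma tensor_local (F : VF -> VF) p :
  (forall X Y, F (X + Y) = F X + F Y) ->
  (forall f (sf : smooth_fun f) X, F (fsmul sf X) = fsmul sf (F X)) ->
  forall X Y, val X p = val Y p -> val (F X) p = val (F Y) p.
Proof.
by have [n [E [nm fE]]] := frame_at p; move=> FD FM; exact: (tensor_at sg nm fE).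
Qed.

Lemma cov_cong X X' Y p : val X p = val X' p -> val (cov X Y) p = val (cov X' Y) p.
Proof.
apply: (@tensor_local (fun X => cov X Y)) => [A B|f sf A]; first exact: covDl.
exact: cov_fsmul.
Qed.

Lemma Riem_cong1 X X' Y Z p : val X p = val X' p -> val (Riem X Y Z) p = val (Riem X' Y Z) p.
Proof.
apply: (@tensor_local (fun X => Riem X Y Z)) => [A B|f sf A]; first exact: RiemDl.
exact: Riem_fsmul.
Qed.

Lemma Riem_cong2 X Y Y' Z p : val Y p = val Y' p -> val (Riem X Y Z) p = val (Riem X Y' Z) p.
Proof.
apply: (@tensor_local (fun Y => Riem X Y Z)) => [A B|f sf A]; first exact: RiemDm.
exact: Riem_fsmul2.
Qed.

Lemma Riem_cong3 X Y Z Z' p : val Z p = val Z' p -> val (Riem X Y Z) p = val (Riem X Y Z') p.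
Proof.
apply: (@tensor_local (fun Z => Riem X Y Z)) => [A B|f sf A]; first exact: RiemDr.
exact: Riem_fsmul3.
Qed.

Lemma dRiem_cong X X' Y Z T p : val X p = val X' p ->
  val (dRiem X Y Z T) p = val (dRiem X' Y Z T) p.
Proof.
apply: (@tensor_local (fun X => dRiem X Y Z T)) => [A B|f sf A]; first exact: dRiemDl.
exact: dRiem_fsmul.
Qed.

Lemma ip_cong X X' Y p : val X p = val X' p -> ip X Y p = ip X' Y p.
Proof. by rewrite /field_inner => ->. Qed.

Lemma val0_ip X Y p : val X p = 0 -> ip X Y p = 0.
Proof. by move=> X0; rewrite (@ip_cong X 0)// (ip0 sg). Qed.

(* Up to a multiple of the second argument, the first one is orthogonal to [V]. *)
Lemma skew_eq0 p (B : VF -> VF -> R) :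
  (forall X Y, B X Y = - B Y X) ->
  (forall X Y Z c, B (X + c *: Y) Z = B X Z + c * B Y Z) ->
  (forall X Y, perp X p -> B X Y = 0) ->
  forall X Y, B X Y = 0.
Proof.
move=> Bs Bl B0 X Y; have BYY : B Y Y = 0 by have := Bs Y Y => ?; lra.
have [Y0|Y0] := eqVneq (ip Y V p) 0; first by rewrite Bs B0// oppr0.
pose c := ip X V p / ip Y V p.
rewrite -[X](subrK (c *: Y)) Bl BYY mulr0 addr0 B0//.
by rewrite /perp (ipB sg) (ipZ sg) divfK ?subrr.
Qed.

Lemma cov_comm K L : KK K -> KK L -> cov K L = cov L K.
Proof. by move=> kK kL; apply/eqP; rewrite -subr_eq0; apply/eqP/KK_comm. Qed.

Lemma act_ip0 X Y Z p : (forall q, ip Y Z q = 0) ->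
  ip (cov X Y) Z p = - ip Y (cov X Z) p.
Proof.
move=> YZ0; apply/eqP; rewrite -addr_eq0 -(act_ip lc).
have -> : ip Y Z = (fun=> 0) by apply/funext.
by rewrite act_cst.
Qed.

(** Put a = g(cov K V, X), b = g(cov X K, V), c = g(cov X V, K). Commutation and the Killing
    equation for [K] give a = -b, differentiating g(K, V) = 0 gives b = -c, and the Killing equation
    for [V] gives c = -a; so a = 0. *)
Lemma cov_KV K X p : KK K -> ip (cov K V) X p = 0.
Proof.
move=> kK; have e1 : ip (cov K V) X p = - ip V (cov X K) p.
  by rewrite (cov_comm kK KK_V); apply: killing_ip; exact: KK_killing.
have e2 := act_ip0 X p (fun q => KK_perp q kK).
have e3 : ip (cov X V) K p = - ip X (cov K V) p.
  by apply: killing_ip; exact: KK_killing.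
move: e1 e2 e3.
rewrite (ipC sg V) (ipC sg K) (ipC sg X) => *; lra.
Qed.

Lemma V_parallel X : cov X V = 0.
Proof.
apply: (eq_vfieldT_ip sg) => Y p; rewrite (ip0 sg).
apply: (@skew_eq0 p (fun X Y => ip (cov X V) Y p)).
- move=> A B; rewrite (killing_ip _ _ _ (KK_killing KK_V)).
  by rewrite (ipC sg A).
- by move=> A B D c; rewrite (covDl lc) (covZl lc) (ipD sg) (ipZ sg).
- move=> A B /perp_KK [K kK KA]; rewrite -(ip_cong _ (cov_cong V KA)).
  exact: cov_KV.
Qed.

Lemma cov_KKK K L N p : KK K -> KK L -> KK N -> ip (cov K L) N p = 0.
Proof.
have e (A B D : VF) : KK A -> KK B -> KK D ->
  ip (cov A B) D p = - ip (cov D B) A p /\ ip (cov A B) D p = ip (cov B A) D p.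
  move=> kA kB kD; split; last by rewrite (cov_comm kA kB).
  by rewrite (killing_ip _ _ _ (KK_killing kB)) (ipC sg A).
move=> kK kL kN.
(* Over all six orderings the symmetry in the first two slots and the skewness in the outer two form
   a linear system with only the zero solution. *)
have [a1 a2] := e _ _ _ kK kL kN; have [b1 b2] := e _ _ _ kN kL kK.
have [c1 c2] := e _ _ _ kL kN kK; have [d1 d2] := e _ _ _ kK kN kL.
have [f1 f2] := e _ _ _ kN kK kL; have [h1 h2] := e _ _ _ kL kK kN.
lra.
Qed.

Lemma cov_perp X L p : KK L -> perp (cov X L) p.
Proof.
move=> kL; rewrite /perp (killing_ip _ _ _ (KK_killing kL)).
by rewrite -(cov_comm kL KK_V) (ipC sg) cov_KV// oppr0.
Qed.

Lemma cov_vert X L p : KK L -> perp X p -> vert (cov X L) p.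
Proof.
move=> kL /perp_KK [K kK KX] Y /perp_KK [N kN NY].
rewrite -(ip_cong _ (cov_cong L KX)) (ipC sg) -(ip_cong _ NY) (ipC sg).
exact: cov_KKK.
Qed.

(** Choose [U] transverse to the hyperplane, so that each [Y] is a hyperplane part plus a multiple
    of [U]. Both [X] and [V] are orthogonal to the hyperplane, and [c] makes X - cV orthogonal to
    [U] as well. *)
Lemma vertE X p : vert X p -> exists c, val X p = c *: val V p.
Proof.
move=> vX.
have [U U0] := ip_neq0 sg (V_neq0 (p := p)).
exists (ip X U p / ip V U p); apply/eqP; rewrite -subr_eq0; apply/eqP.
set c := _ / _; rewrite -[LHS]/(val (X - c *: V) p); apply: (ip_eq0 sg) => Y.
have V0 : ip V U p != 0 by rewrite (ipC sg).
pose d := ip Y V p / ip U V p.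
have pY : perp (Y - d *: U) p by rewrite /perp (ipB sg) (ipZ sg) divfK ?subrr.
rewrite (ipC sg) -[Y](subrK (d *: U)) (ip_lin sg) (ipBr sg) ![ip _ (c *: V) p](ipC sg).
rewrite (ipBr sg) ![ip _ (c *: V) p](ipC sg) !(ipZ sg) (ipC sg _ X) vX//.
rewrite (ipC sg V) pY mulr0 subrr add0r (ipC sg U X) divfK ?subrr ?mulr0//.
Qed.

Lemma Riem_V3 X Y : Riem X Y V = 0.
Proof. by rewrite /Rm !V_parallel !(cov0r lc) !subrr. Qed.

(** As [V] is parallel, [lie V] coincides with [cov V]; the affinity of the Killing field [V] then
    reads R(V, X) Y = 0. *)
Lemma Riem_V1 X Y : Riem V X Y = 0.
Proof.
have brV Z : lie V Z = cov V Z by rewrite /lieb V_parallel subr0.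
rewrite /Rm -brV (killing_affine sg _ _ (KK_killing KK_V)) !brV.
by apply: vfieldT_ext => p f; rewrite !(evD, evN, ev0); ring.
Qed.

Lemma Riem_perp X Y Z p : perp (Riem X Y Z) p.
Proof. by rewrite /perp (Riem_skew_adj sg) Riem_V3 (ipC sg) (ip0 sg) oppr0. Qed.

Lemma Riem_KKK K L N p : KK K -> KK L -> KK N -> val (Riem K L N) p = 0.
Proof.
move=> kK kL kN.
(* Affinity of [A] with zero brackets gives [A, cov B D] = 0, so cov A (cov B D) is the derivative
   of [A] along [cov B D]. At [p] the latter is a multiple of [V], and cov V A = cov A V = 0. *)
have nn A B D : KK A -> KK B -> KK D -> val (cov A (cov B D)) p = 0.
  move=> kA kB kD.
  have := killing_affine sg B D (KK_killing kA).
  rewrite (KK_comm kA kB) (KK_comm kA kD) (cov0l lc) (cov0r lc) addr0 => /subr0_eq ->.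
  have [c cE] : exists c, val (cov B D) p = c *: val V p.
    by apply: vertE; apply: cov_vert => //; exact: KK_perp.
  rewrite (@cov_cong _ (c *: V))// (covZl lc) (cov_comm KK_V kA) V_parallel.
  by rewrite scaler0.
rewrite /Rm (KK_comm kK kL) (cov0l lc) subr0.
by rewrite -[LHS]/(val (cov K (cov L N)) p - val (cov L (cov K N)) p) !nn ?subrr.
Qed.

Lemma Riem_perp3 X Y Z p : perp X p -> perp Y p -> perp Z p -> val (Riem X Y Z) p = 0.
Proof.
move=> /perp_KK [K kK /Riem_cong1 <-] /perp_KK [L kL /Riem_cong2 <-].
move=> /perp_KK [N kN /Riem_cong3 <-]; exact: Riem_KKK.
Qed.

(** Affinity of [K] gives R(K, Y) N = cov (cov Y N) K - cov Y (cov K N). Pairing with [L], the first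
    term dies by [cov_vert]; in the second the derivative moves to [L], leaving a vertical vector
    against one orthogonal to [V]. *)
Lemma Riem_vert X Y Z p : perp X p -> perp Z p -> vert (Riem X Y Z) p.
Proof.
move=> /perp_KK [K kK /Riem_cong1 KX] /perp_KK [N kN /Riem_cong3 NZ] W pW.
have [L kL LW] := perp_KK pW.
rewrite -(ip_cong _ (KX Y Z)) -(ip_cong _ (NZ K Y)) (ipC sg) -(ip_cong _ LW) (ipC sg).
have -> : Riem K Y N = cov (cov Y N) K - cov Y (cov K N).
  have := killing_affine sg Y N (KK_killing kK).
  rewrite (KK_comm kK kN) (cov0r lc) addr0 /Rm => <-; rewrite /lieb.
  by apply: vfieldT_ext => q f; rewrite !(evD, evN); ring.
have pN A B : KK B -> perp (cov A B) p by move=> ?; exact: cov_perp.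
rewrite (ipB sg) (cov_vert kK (pN _ _ kN)); last exact: KK_perp.
rewrite act_ip0 => [|q]; last exact: cov_KKK.
by rewrite (cov_vert kN (KK_perp p kK) (pN Y L kL)) !oppr0 addr0.
Qed.

Lemma Riem_vert1 X Y Z p : vert X p -> val (Riem X Y Z) p = 0.
Proof.
move=> /vertE [c cE]; rewrite (@Riem_cong1 _ (c *: V))//.
by rewrite (RiemZl lc) Riem_V1 scaler0.
Qed.

(** The form g(R(X, Y) Z, W) is skew in [Z], [W] and vanishes for [Z] orthogonal to [V], so [Z] may
    be arbitrary. This is the curvature condition of a pp-wave. *)
Lemma Riem_perp2 X Y Z p : perp X p -> perp Y p -> val (Riem X Y Z) p = 0.
Proof.
move=> pX pY; apply: (ip_eq0 sg) => W.
apply: (@skew_eq0 p (fun Z W => ip (Riem X Y Z) W p)).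
- by move=> A B; rewrite (Riem_skew_adj sg) (ipC sg A).
- by move=> A B D c; rewrite (RiemDr lc) (RiemZr lc) (ip_lin sg).
- by move=> A B pA; apply: val0_ip; exact: Riem_perp3.
Qed.

Lemma dRiem_killing L Y Z T p : KK L -> val (dRiem L Y Z T) p = 0.
Proof.
move=> kL; have kkL := KK_killing kL; apply: (ip_eq0 sg) => W.
apply: (@skew_eq0 p (fun Y Z => ip (dRiem L Y Z T) W p)) => [A B|A B D c|{}Y {}Z pY].
- by rewrite (dRiem_skew lc) (ipN sg).
- by rewrite (dRiemZ lc) (ipD sg) (ipZ sg).
have ipB3 (A B D F : VF) :
  ip (A - B - D - F) W p = ip A W p - ip B W p - ip D W p - ip F W p.
  by rewrite !(ipB sg).
rewrite (killing_dRiem sg _ _ _ kkL) ipB3.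
(* The term with [cov Y L] vanishes since that vector is vertical, and the one with [cov Z L] since
   [Y] and that vector are both orthogonal to [V]. *)
rewrite (val0_ip _ (Riem_vert1 _ _ (cov_vert kL pY))).
rewrite (val0_ip _ (Riem_perp2 _ pY (cov_perp _ _ kL))) !subr0.
(* The two remaining terms become skew in [T], [W] once [L] and the curvature are moved across the
   metric. For [T] orthogonal to [V], each pairs a vertical vector with one orthogonal to [V]. *)
pose B T W := ip (cov T L) (Riem Y Z W) p - ip (Riem Y Z T) (cov W L) p.
have -> : ip (cov (Riem Y Z T) L) W p - ip (Riem Y Z (cov T L)) W p = B T W.
  rewrite /B (killing_ip (Riem Y Z T) W p kkL) (Riem_skew_adj sg lc Y Z (cov T L)); lra.
apply: (@skew_eq0 p) => [A D|A A' D c|A D pA]; rewrite /B.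
- by rewrite (ipC sg (cov A L)) (ipC sg (Riem Y Z A)) opprB.
- rewrite (covDl lc) (covZl lc) (RiemDr lc) (RiemZr lc).
  rewrite (ip_lin sg (cov A L)) (ip_lin sg (Riem Y Z A)); ring.
- rewrite (cov_vert kL pA) ?(Riem_vert _ pY pA) ?subrr//; first exact: cov_perp.
  exact: Riem_perp.
Qed.

Lemma dRiem_perp X Y Z T p : perp X p -> val (dRiem X Y Z T) p = 0.
Proof. by move=> /perp_KK [L kL /dRiem_cong <-]; exact: dRiem_killing. Qed.

End NullDistribution.

(** * The real span of the given Killing fields *)

Lemma lin_span_range (R : realType) (V : lmodType R) n (e : 'I_n -> V) (v : V) :
  lin_span (range e) v -> exists a : 'I_n -> R, v = \sum_i a i *: e i.
Proof.
move=> [k [e' [c [He ->]]]].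
have /choice[f fe] : forall j, exists i, e i = e' j.
  by move=> j; have [i _ <-] := He j; exists i.
(* A member of the span may use the same [e i] repeatedly; its coefficients are collected along
   [f]. *)
exists (fun i => \sum_(j | f j == i) c j).
rewrite (partition_big f xpredT)//=; apply: eq_bigr => i _.
by rewrite scaler_suml; apply: eq_bigr => j /eqP <-; rewrite fe.
Qed.

Section KillingSpan.
Variables (R : realType) (m : nat) (M : smooth_manifold R m).
Variables (g : metric M) (nabla : rough_field M -> rough_field M -> rough_field M).
Variable Ks : set (rough_field M).
Hypotheses (sg : semi_riemannian g) (lc : levi_civita g nabla).
Hypothesis Ks_killing : forall K, Ks K -> killing g nabla K.
Hypothesis Ks_comm : forall K L, Ks K -> Ks L -> bracket K L = 0.
Hypothesis Ks_dim : forall p : M, has_dim m.-1 (pointwise_span Ks p).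

Local Notation VF := (vfieldT M).
Local Notation ip := (field_inner g).

(** Only constant coefficients occur, so the Killing equation and commutation pass to the span; the
    inductive form lets both be proved by induction. *)
Inductive field_span : VF -> Prop :=
| field_span0 : field_span 0
| field_spanP (a : R) (X Y : VF) :
    field_span X -> field_span Y -> field_span (a *: X + Y)
| field_span_mem (X : VF) : Ks (val X) -> field_span X.

Lemma field_span_sum n (a : 'I_n -> R) (F : 'I_n -> VF) :
  (forall i, field_span (F i)) -> field_span (\sum_i a i *: F i).
Proof.
move=> sF; apply: (big_ind field_span); first exact: field_span0.
  by move=> X Y sX sY; rewrite -[X]scale1r; exact: field_spanP.
by move=> i _; rewrite -[_ *: _]addr0; apply: field_spanP => //; exact: field_span0.
Qed.

Lemma rough_sumE n (a : 'I_n -> R) (F : 'I_n -> rough_field M) p :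
  (\sum_i a i *: F i) p = \sum_i a i *: F i p.
Proof.
by apply: (big_ind2 (fun (X : rough_field M) v => X p = v)) => // X u Y v <- <-.
Qed.

Lemma field_span_lift (W : rough_field M) :
  lin_span Ks W -> exists2 X, field_span X & val X = W.
Proof.
move=> [k [e [c [Ke ->]]]].
pose F i : VF := mk_vfieldT (Ks_killing (Ke i)).1.
exists (\sum_i c i *: F i).
  by apply: field_span_sum => i; apply: field_span_mem; exact: Ke.
apply/funext => p; by rewrite val_sum rough_sumE.
Qed.

(** The coefficients of [u] at [p] are kept constant over the manifold, so that the lift stays in
    the real span. *)
Lemma pointwise_span_lift p u : pointwise_span Ks p u ->
  exists2 X, field_span X & val X p = u.
Proof.
move=> [k [e [c [He ->]]]].
have /choice[F Fe] : forall i, exists K, Ks K /\ K p = e i.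
  by move=> i; have [K KK <-] := He i; exists K.
have KF i : Ks (F i) by case: (Fe i).
pose G i : VF := mk_vfieldT (Ks_killing (KF i)).1.
exists (\sum_i c i *: G i).
  by apply: field_span_sum => i; apply: field_span_mem; exact: KF.
by rewrite val_sum; apply: eq_bigr => i _; case: (Fe i) => _ <-.
Qed.

Lemma pointwise_span_val p (W : rough_field M) :
  lin_span Ks W -> pointwise_span Ks p (W p).
Proof.
move=> [k [e [c [Ke ->]]]]; exists k, (fun i => e i p), c; split.
  by move=> i; exists (e i).
exact: rough_sumE.
Qed.

Lemma field_span_killing X : field_span X -> is_killing lc X.
Proof.
elim=> {X} [|a X Y _ kX _ kY|X KX] A B p.
- by rewrite !(cov0r lc) (ip0 sg) (ipC sg) (ip0 sg) addr0.
- have := kX A B p; have := kY A B p.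
  rewrite !(covDr lc, covZr lc) (ipC sg A (_ + _)) (ipC sg A) (ipC sg A).
  by rewrite !(ipD sg) !(ipZ sg) => h1 h2; nra.
- have [_ H] := Ks_killing KX.
  by have /(congr1 (fun f => f p)) := H _ _ (vfieldTP A) (vfieldTP B).
Qed.

Lemma field_span_comm X Y : field_span X -> field_span Y -> lieb lc X Y = 0.
Proof.
move=> sX sY.
elim: sX => {X} [|a X X' _ IH _ IH'|X KX].
- by rewrite /lieb (cov0l lc) (cov0r lc) subrr.
- move: IH IH'; rewrite /lieb !(covDl lc, covDr lc, covZl lc, covZr lc) => h1 h2.
  by rewrite opprD addrACA h2 addr0 -scalerBr h1 scaler0.
elim: sY => {Y} [|a Y Y' _ IH _ IH'|Y KY].
- by rewrite /lieb (cov0l lc) (cov0r lc) subrr.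
- move: IH IH'; rewrite /lieb !(covDl lc, covDr lc, covZl lc, covZr lc) => h1 h2.
  by rewrite opprD addrACA h2 addr0 -scalerBr h1 scaler0.
- by apply: val_inj; rewrite val_lie; exact: Ks_comm.
Qed.

Variable V : VF.
Hypothesis V_span : field_span V.
Hypothesis V_lin_span : lin_span Ks (val V).
Hypothesis V_neq0 : forall p, val V p <> 0.
Hypothesis V_perp : forall K p, Ks K -> g p (val V p) (K p) = 0.

Lemma field_span_perp X p : field_span X -> ip X V p = 0.
Proof.
elim=> {X} [|a X Y _ hX _ hY|X KX]; first exact: ip0.
  by rewrite (ipD sg) (ipZ sg) hX hY mulr0 addr0.
by rewrite (ipC sg); exact: V_perp.
Qed.

(** A basis of the distribution at [p] lifts to fields of the span, and nondegeneracy supplies a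
    field [U] transverse to the orthogonal complement of [V]. *)
Lemma span_frame p : exists n (L : 'I_n -> VF) (U : VF),
  [/\ n.+1 = m, forall i, field_span (L i), lin_free (fun i => val (L i) p)
    & ip U V p != 0].
Proof.
have [e [fe De]] := Ks_dim p.
have /choice[L Le] : forall i, exists X, field_span X /\ val X p = e i.
  move=> i; have [X sX Xe] : exists2 X, field_span X & val X p = e i.
    apply: pointwise_span_lift; rewrite De.
    exists 1%N, (fun=> e i), (fun=> 1); split; first by move=> _; exists i.
    by rewrite big_ord1 scale1r.
  by exists X.
have [U U0] := ip_neq0 sg (V_neq0 (p := p)).
exists m.-1, L, U; split => //.
(* If m were 0, then [m.-1] would be 0 too and the span trivial, against [V_neq0]; hence
   [m.-1.+1 = m]. *)
- rewrite prednK// lt0n; apply/eqP => m0; apply: (V_neq0 (p := p)).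
  have := pointwise_span_val p V_lin_span; rewrite De => /lin_span_range[a ->].
  rewrite big1// => i _; have m1 : (m.-1 <= 0)%N by rewrite m0.
  by have := leq_trans (ltn_ord i) m1.
- by move=> i; case: (Le i).
- by move=> c c0; apply: fe; rewrite -[RHS]c0; apply: eq_bigr => i _; case: (Le i) => _ ->.
Qed.

Definition add_field n (L : 'I_n -> VF) (U : VF) (i : 'I_n.+1) : VF :=
  if unlift ord0 i is Some j then L j else U.

Lemma add_field_sum n (L : 'I_n -> VF) (U : VF) (c : 'I_n.+1 -> R) :
  \sum_i c i *: add_field L U i = c ord0 *: U + \sum_i c (lift ord0 i) *: L i.
Proof.
rewrite big_ord_recl /add_field unlift_none; congr (_ + _).
by apply: eq_bigr => i _; rewrite liftK.
Qed.

Lemma add_field_ip n (L : 'I_n -> VF) (U : VF) (c : 'I_n.+1 -> R) p :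
  (forall i, field_span (L i)) ->
  ip (\sum_i c i *: add_field L U i) V p = c ord0 * ip U V p.
Proof.
move=> sL; rewrite add_field_sum (ipD sg) (ipZ sg).
by rewrite (@field_span_perp (\sum_i _ *: L i)) ?addr0//; exact: field_span_sum.
Qed.

(** Pairing a linear relation with [V] removes all the [L i] and forces the coefficient of [U] to be
    0; the rest is freeness of [L]. *)
Lemma add_field_free n (L : 'I_n -> VF) (U : VF) p :
  (forall i, field_span (L i)) -> lin_free (fun i => val (L i) p) ->
  ip U V p != 0 -> lin_free (fun i => val (add_field L U i) p).
Proof.
move=> sL fL U0 c; rewrite -val_sum => cE.
have c0 : c ord0 = 0.
  apply/eqP; rewrite -(mulIr_eq0 _ (mulIf U0)) -(add_field_ip U c p sL).
  by rewrite /field_inner cE -(ip0 sg V p).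
move: cE; rewrite add_field_sum c0 scale0r add0r val_sum => /fL cl i.
by case: (unliftP ord0 i) => [j|] ->; rewrite ?c0// cl.
Qed.

Lemma span_frame_at p : exists n (E : 'I_n -> VF),
  n = m /\ lin_free (fun i => val (E i) p).
Proof.
have [n [L [U [nm sL fL U0]]]] := span_frame p.
by exists n.+1, (add_field L U); split=> //; exact: add_field_free.
Qed.

(** Expand [X] in the frame: orthogonality to [V] kills the coefficient of [U], and the other
    coefficients at [p], taken as constants, give [K]. *)
Lemma span_perp X p : ip X V p = 0 -> exists2 K, field_span K & val K p = val X p.
Proof.
move=> pX; have [n [L [U [nm sL fL U0]]]] := span_frame p.
have [a XE] := tangent_basis nm (fun i => tangent_val (add_field L U i) p)
  (add_field_free sL fL U0) (tangent_val X p).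
rewrite -val_sum in XE.
have a0 : a ord0 = 0.
  apply/eqP; rewrite -(mulIr_eq0 _ (mulIf U0)) -(add_field_ip U a p sL).
  by rewrite /field_inner -XE; apply/eqP.
rewrite add_field_sum a0 scale0r add0r in XE.
by exists (\sum_i a (lift ord0 i) *: L i) => //; exact: field_span_sum.
Qed.

End KillingSpan.


Theorem theorem3 (R : realType) (m : nat) (M : smooth_manifold R m)
    (g : metric M) (nabla : rough_field M -> rough_field M -> rough_field M)
    (Ks : set (rough_field M)) :
  semi_riemannian g ->
  levi_civita g nabla ->
  (forall K, Ks K -> killing g nabla K) ->
  (forall K L, Ks K -> Ks L -> bracket K L = 0) ->
  (forall p : M, has_dim m.-1 (pointwise_span Ks p)) ->
  (forall p : M, degenerate_on (g p) (pointwise_span Ks p)) ->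
  (exists W, lin_span Ks W /\
     forall p : M, W p <> 0 /\ forall K, Ks K -> g p (W p) (K p) = 0) ->
  (exists V, [/\ parallel nabla V, null_field g V,
                 curv_flat_on_perp g nabla V
               & curv_parallel_along_perp g nabla V]) /\
  (lorentzian g -> curv_nonzero nabla -> plane_wave g nabla).
Proof.
move=> sg lc Kk Kc Kd _ [W [WK HW]].
(* [W] is a constant combination of Killing fields, so it is smooth and lies in the span; it is the
   field [V] sought. *)
have [V sV VW] := field_span_lift Kk WK; subst W.
have V0 p : val V p <> 0 by case: (HW p).
have Vp K p : Ks K -> g p (val V p) (K p) = 0 by case: (HW p) => _; exact.
have kill := field_span_killing sg lc Kk.
have comm := field_span_comm lc Kc.
have perpV := fun K p => @field_span_perp _ _ _ _ _ sg _ Vp K p.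
have perpK := span_perp sg Kk Kd WK V0 Vp.
have frame := span_frame_at sg Kk Kd WK V0 Vp.
have parV : parallel nabla (val V).
  split=> [|X vX]; first exact: vfieldTP.
  exact: (congr1 val (V_parallel sg kill comm sV perpV perpK frame (mk_vfieldT vX))).
have nullV : null_field g (val V).
  by split=> [|p]; [exact: vfieldTP|split=> //; exact: perpV].
(* The third argument is arbitrary here, which serves the pp-wave condition; flatness on the
   complement of [V] is the restriction of this to [Z] orthogonal to [V]. *)
have endo : curv_endo_zero_on_perp g nabla (val V).
  move=> p X Y Z [vX pX] [vY pY] vZ.
  rewrite -(val_Riem lc (mk_vfieldT vX) (mk_vfieldT vY) (mk_vfieldT vZ)).
  exact: (Riem_perp2 sg kill comm sV perpV V0 perpK frame).
have parC : curv_parallel_along_perp g nabla (val V).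
  move=> p X [vX pX] Y Z T vY vZ vT.
  rewrite -(val_dRiem lc (mk_vfieldT vX) (mk_vfieldT vY) (mk_vfieldT vZ) (mk_vfieldT vT)).
  exact: (dRiem_perp sg kill comm sV perpV V0 perpK frame).
split; last by move=> lg cn; exists (val V).
exists (val V); split=> // p X Y Z pX pY [vZ _]; exact: endo.
Qed.
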